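(* Let $(G,\{T_v,\rho_v\}_{v\in V},\{\phi_e\}_{e\in E})$ be a Mauldin-Williams graph such that the graph $G=(V,E,r,s)$ has no sinks and no sources. Let $T=\coprod_{v\in V}T_v$, let $A=C(T)$, and let $\mathcal{X}=C(E\times_G T)$ be the associated $C^*$-correspondence over $A$. Then the Cuntz-Pimsner algebra $\mathcal{O}_{\mathcal{X}}$ is isomorphic to the graph $C^*$-algebra $C^*(G)$.
   Context: Graphs. A graph $G=(V,E,r,s)$ consists of finite sets $V$ (vertices) and $E$ (edges) and maps $r,s:E\to V$ (range and source). No sinks means $s$ is surjective; no sources means $r$ is surjective. Mauldin-Williams graph. A system $(G,\{T_v,\rho_v\}_{v\in V},\{\phi_e\}_{e\in E})$ where $G=(V,E,r,s)$ is a graph, each $(T_v,\rho_v)$ is a nonempty compact metric space, and for each $e\in E$, $\phi_e:T_{r(e)}\to T_{s(e)}$ satisfies $\rho_{s(e)}(\phi_e(x),\phi_e(y))\le c\,\rho_{r(e)}(x,y)$ for all $x,y\in T_{r(e)}$, with a constant $0<c<1$ independent of $e$. The correspondence. Let $T=\coprod_{v\in V}T_v$ (disjoint union), $A=C(T)$, $E\times_G T=\{(e,x)\in E\times T: x\in T_{r(e)}\}$ (a compact space) and $\mathcal{X}=C(E\times_G T)$, with $(\xi\cdot a)(e,x)=\xi(e,x)a(x)$, $(a\cdot\xi)(e,x)=a(\phi_e(x))\,\xi(e,x)$, and $\langle\xi,\eta\rangle_A(x)=\sum_{e\in E,\ x\in T_{r(e)}}\overline{\xi(e,x)}\,\eta(e,x)$,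 for $a\in A$, $\xi,\eta\in\mathcal{X}$. The left action is the $*$-homomorphism $\Phi:A\to\mathcal{L}(\mathcal{X})$, $\Phi(a)\xi=a\cdot\xi$, into the adjointable operators. Cuntz-Pimsner algebra. A Toeplitz representation of $\mathcal{X}$ in a $C^*$-algebra $B$ is a pair $(\psi,\pi)$ with $\psi:\mathcal{X}\to B$ linear and $\pi:A\to B$ a $*$-homomorphism such that $\psi(\xi\cdot a)=\psi(\xi)\pi(a)$, $\psi(a\cdot\xi)=\pi(a)\psi(\xi)$ and $\psi(\xi)^*\psi(\eta)=\pi(\langle\xi,\eta\rangle_A)$. It induces a $*$-homomorphism $\pi^{(1)}:\mathcal{K}(\mathcal{X})\to B$ with $\pi^{(1)}(\Theta_{\xi,\eta})=\psi(\xi)\psi(\eta)^*$, where $\Theta_{\xi,\eta}(\zeta)=\xi\cdot\langle\eta,\zeta\rangle_A$ and $\mathcal{K}(\mathcal{X})$ is the closed linear span of the operators $\Theta_{\xi,\eta}$. Put $J(\mathcal{X})=\Phi^{-1}(\mathcal{K}(\mathcal{X}))$. The representation is Cuntz-Pimsner covariant if $\pi^{(1)}(\Phi(a))=\pi(a)$ for all $a\in J(\mathcal{X})$. $\mathcal{O}_{\mathcal{X}}$ is the $C^*$-algebra generated by a universal Cuntz-Pimsner covariant Toeplitz representation $(k_{\mathcal{X}},k_A)$: every Cuntz-Pimsner covariant Toeplitz representation $(\psi,\pi)$ in $B$ factors through a $*$-homomorphism $\mathcal{O}_{\mathcal{X}}\to B$ carrying $k_{\mathcal{X}}(\xi)$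 to $\psi(\xi)$ and $k_A(a)$ to $\pi(a)$. Graph algebra. $C^*(G)$ is the universal $C^*$-algebra generated by mutually orthogonal projections $\{P_v\}_{v\in V}$ and partial isometries $\{S_e\}_{e\in E}$ with $S_e^*S_e=P_{r(e)}$ for $e\in E$ and $P_v=\sum_{s(f)=v}S_fS_f^*$ for $v\in s(E)$. *)

(* Defs.v *)
From HB Require Import structures.
From mathcomp Require Import all_boot all_order all_algebra.
From mathcomp Require Import all_classical all_reals all_analysis.
From mathcomp Require Import complex.
Set Implicit Arguments.
Unset Strict Implicit.
Unset Printing Implicit Defensive.
Import Order.TTheory GRing.Theory Num.Theory.
Import numFieldNormedType.Exports.
Local Open Scope classical_set_scope.
Local Open Scope ring_scope.

HB.mixin Record isCompactSpace T & Topological T := {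
  compact_setT : compact [set: T] }.
#[short(type="compactSpaceType")]
HB.structure Definition CompactSpace := {T of Topological T & isCompactSpace T}.
#[short(type="compactMetricType")]
HB.structure Definition CompactMetric (K : numDomainType) :=
  {T of Metric K T & isCompactSpace T}.

HB.instance Definition _ (I : finType) (X : I -> compactSpaceType) :=
  isCompactSpace.Build {i : I & X i}
    (sigT_compact finite_finset (fun i => @compact_setT (X i))).

(* The multiplication is an operation of its own, and not that of a MathComp
   ring, because C*-algebras need not be unital; morphisms below need not
   preserve a unit either. *)
HB.mixin Record isCStarAlgebra (R : realType) A
    & CompleteNormedModule R[i] A := {
  cmul : A -> A -> A;
  star : A -> A;
  cmulA : associative cmul;
  cmulDl : left_distributive cmul +%R;
  cmulDr : right_distributive cmul +%R;
  cmulZl : forall (k : R[i]) (a b : A), cmul (k *: a) b = k *: cmul a b;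
  cmulZr : forall (k : R[i]) (a b : A), cmul a (k *: b) = k *: cmul a b;
  starK : involutive star;
  starD : {morph star : a b / a + b};
  starZ : forall (k : R[i]) (a : A), star (k *: a) = k^* *: star a;
  starM : forall a b : A, star (cmul a b) = cmul (star b) (star a);
  norm_cmul : forall a b : A, `|cmul a b| <= `|a| * `|b|;
  norm_star_cmul : forall a : A, `|cmul (star a) a| = `|a| ^+ 2
}.

#[short(type="cstarAlgType")]
HB.structure Definition CStarAlgebra (R : realType) :=
  {A of CompleteNormedModule R[i] A & isCStarAlgebra R A}.

Notation "a ** b" := (cmul a b) (at level 40, left associativity) : ring_scope.

Section CStarMorphisms.
Variable R : realType.
Implicit Types A B : cstarAlgType R.

Definition star_hom A B (f : A -> B) : Prop :=
  [/\ forall (k : R[i]) a b, f (k *: a + b) = k *: f a + f b,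
      forall a b, f (a ** b) = f a ** f b
    & forall a, f (star a) = star (f a)].

Definition star_isomorphic A B : Prop :=
  exists f : A -> B, star_hom f /\ bijective f.

Definition closed_star_subalgebra A (D : set A) : Prop :=
  [/\ closed D, D 0,
      forall (k : R[i]) a b, D a -> D b -> D (k *: a + b),
      forall a b, D a -> D b -> D (a ** b)
    & forall a, D a -> D (star a)].

Definition generates A (S : set A) : Prop :=
  forall D : set A, closed_star_subalgebra D -> S `<=` D -> D = [set: A].

End CStarMorphisms.

Record correspondence (R : realType) (A : cstarAlgType R) := Correspondence {
  corr_sort :> lmodType R[i];
  inner : corr_sort -> corr_sort -> A;
  ract : corr_sort -> A -> corr_sort;
  lact : A -> corr_sort -> corr_sort;
  ract_linearl : forall (k : R[i]) x y a,
    ract (k *: x + y) a = k *: ract x a + ract y a;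
  ract_linearr : forall (k : R[i]) x a b,
    ract x (k *: a + b) = k *: ract x a + ract x b;
  ractM : forall x a b, ract x (a ** b) = ract (ract x a) b;
  inner_linear : forall (k : R[i]) x y z,
    inner x (k *: y + z) = k *: inner x y + inner x z;
  inner_ract : forall x y a, inner x (ract y a) = inner x y ** a;
  star_inner : forall x y, star (inner x y) = inner y x;
  inner_positive : forall x, exists b, inner x x = star b ** b;
  inner_definite : forall x, inner x x = 0 -> x = 0;
  (* Completeness for the norm sqrt |<x, x>|. *)
  corr_complete : forall u : nat -> corr_sort,
    (forall e : R[i], 0 < e -> exists N : nat, forall m n : nat,
       (N <= m)%N -> (N <= n)%N ->
       sqrtC `|inner (u m - u n) (u m - u n)| < e) ->
    exists x, forall e : R[i], 0 < e -> exists N : nat, forall n : nat,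
       (N <= n)%N -> sqrtC `|inner (u n - x) (u n - x)| < e;
  lact_linear : forall (k : R[i]) a b x,
    lact (k *: a + b) x = k *: lact a x + lact b x;
  lactM : forall a b x, lact (a ** b) x = lact a (lact b x);
  (* With lact_linear and lactM this makes lact a *-homomorphism into L(X):
     lact a is adjointable with adjoint lact (star a). *)
  lact_adjoint : forall a x y, inner (lact a x) y = inner x (lact (star a) y)
}.

Section CompactOperators.
Variables (R : realType) (A : cstarAlgType R) (X : correspondence A).
Implicit Types (x y z : X) (S T : X -> X).

Definition corr_norm x : R[i] := sqrtC `|inner x x|.

Definition adjoint T S : Prop := forall x y, inner (T x) y = inner x (S y).

Definition adjointable T : Prop := exists S, adjoint T S.

Definition theta x y : X -> X := fun z => ract x (inner y z).

(* The scalars of a linear combination of operators theta are absorbed in the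
   first argument of theta, so finite sums suffice for the linear span. *)
Definition theta_span T : Prop :=
  exists s : seq (X * X), forall z, T z = \sum_(p <- s) theta p.1 p.2 z.

Definition compact_operator T : Prop :=
  adjointable T /\
  forall e : R[i], 0 < e -> exists2 S, theta_span S &
    forall z, corr_norm (T z - S z) <= e * corr_norm z.

End CompactOperators.

Section CuntzPimsner.
Variables (R : realType) (A : cstarAlgType R) (X : correspondence A).

Section Representation.
Variables (B : cstarAlgType R) (psi : X -> B) (pi : A -> B).

Definition toeplitz : Prop :=
  [/\ forall (k : R[i]) x y, psi (k *: x + y) = k *: psi x + psi y,
      star_hom pi,
      forall x a, psi (ract x a) = psi x ** pi a,
      forall a x, psi (lact a x) = pi a ** psi x
    & forall x y, star (psi x) ** psi y = pi (inner x y)].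

(* pi1 is the *-homomorphism K(X) -> B induced by (psi, pi); its values off
   K(X) are irrelevant. *)
Definition induced_on_compacts (pi1 : (X -> X) -> B) : Prop :=
  [/\ forall (k : R[i]) S T, compact_operator S -> compact_operator T ->
        pi1 (fun z => k *: S z + T z) = k *: pi1 S + pi1 T,
      forall S T, compact_operator S -> compact_operator T ->
        pi1 (S \o T) = pi1 S ** pi1 T,
      forall S T, compact_operator S -> adjoint S T -> pi1 T = star (pi1 S)
    & forall x y, pi1 (theta x y) = psi x ** star (psi y)].

Definition cp_covariant : Prop :=
  exists2 pi1, induced_on_compacts pi1 &
    forall a, compact_operator (lact a : X -> X) -> pi1 (lact a) = pi a.

End Representation.

Record cuntz_pimsner_algebra (O : cstarAlgType R) (kX : X -> O) (kA : A -> O) :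
    Prop := CuntzPimsnerAlgebra {
  cp_toeplitz : toeplitz kX kA;
  cp_covariance : cp_covariant kX kA;
  cp_generated : generates (range kX `|` range kA);
  cp_universal : forall (B : cstarAlgType R) (psi : X -> B) (pi : A -> B),
    toeplitz psi pi -> cp_covariant psi pi ->
    exists f : O -> B, [/\ star_hom f, forall x, f (kX x) = psi x
                         & forall a, f (kA a) = pi a]
}.

End CuntzPimsner.

Record graph := Graph {
  vertex : finType;
  edge : finType;
  rng : edge -> vertex;
  src : edge -> vertex
}.

Definition no_sinks (G : graph) : Prop :=
  forall v, exists e : edge G, src e = v.

Definition no_sources (G : graph) : Prop :=
  forall v, exists e : edge G, rng e = v.

Section GraphAlgebra.
Variables (R : realType) (G : graph).

Definition projection (B : cstarAlgType R) (p : B) : Prop :=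
  star p = p /\ p ** p = p.

Definition partial_isometry (B : cstarAlgType R) (s : B) : Prop :=
  s ** star s ** s = s.

Record cuntz_krieger (B : cstarAlgType R) (P : vertex G -> B)
    (S : edge G -> B) : Prop := CuntzKrieger {
  ck_projection : forall v, projection (P v);
  ck_orthogonal : forall v w, v != w -> P v ** P w = 0;
  ck_partial_isometry : forall e, partial_isometry (S e);
  ck_initial : forall e, star (S e) ** S e = P (rng e);
  ck_final : forall v, (exists e : edge G, src e = v) ->
    P v = \sum_(f : edge G | src f == v) (S f ** star (S f))
}.

Record graph_algebra (C : cstarAlgType R) (P : vertex G -> C)
    (S : edge G -> C) : Prop := GraphAlgebra {
  ga_family : cuntz_krieger P S;
  ga_generated : generates (range P `|` range S);
  ga_universal : forall (B : cstarAlgType R) (Q : vertex G -> B)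
      (T : edge G -> B), cuntz_krieger Q T ->
    exists f : C -> B, [/\ star_hom f, forall v, f (P v) = Q v
                         & forall e, f (S e) = T e]
}.

End GraphAlgebra.

Record mauldin_williams (R : realType) (G : graph) := MauldinWilliams {
  mw_space : vertex G -> compactMetricType R;
  mw_space_neq0 : forall v, [set: mw_space v] !=set0;
  mw_map : forall e : edge G, mw_space (rng e) -> mw_space (src e);
  mw_contraction : exists c : R, 0 < c < 1 /\
    forall e (x y : mw_space (rng e)),
      mdist (mw_map x) (mw_map y) <= c * mdist x y
}.

Section ContinuousFieldOps.
Variables (C : numFieldType) (T : topologicalType).
Implicit Types f g : T -> C^o.

Lemma continuous_addf f g : continuous f -> continuous g ->
  continuous (fun x => f x + g x).
Proof.
by move=> cf cg x; apply: (@continuousD C C^o); [exact: cf|exact: cg].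
Qed.

Lemma continuous_oppf f : continuous f -> continuous (fun x => - f x).
Proof. by move=> cf x; apply: (@continuousN C C^o); exact: cf. Qed.

Lemma continuous_mulf f g : continuous f -> continuous g ->
  continuous (fun x => (f x : C) * g x : C^o).
Proof. by move=> cf cg x; apply: (@continuousM C); [exact: cf|exact: cg]. Qed.

Lemma continuous_sumf (I : Type) (r : seq I) (P : pred I) (f : I -> T -> C^o) :
  (forall i, continuous (f i)) ->
  continuous (fun x => (\sum_(i <- r | P i) (f i x : C)) : C^o).
Proof.
move=> cf; elim: r => [|i r IH] x.
  rewrite /continuous_at (eq_cvg _ _ (_ : _ =1 cst 0)) ?big_nil.
    exact: cvg_cst.
  by move=> y; rewrite big_nil.
case: (boolP (P i)) => Pi.
  have : (fun x => \sum_(j <- i :: r | P j) (f j x : C) : C^o) =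
         (fun x => f i x + \sum_(j <- r | P j) f j x).
    by apply/funext => y; rewrite big_cons Pi.
  by move=> ->; apply: continuous_addf.
have -> : (fun x => \sum_(j <- i :: r | P j) (f j x : C) : C^o) =
          (fun x => \sum_(j <- r | P j) f j x).
  by apply/funext => y; rewrite big_cons (negbTE Pi).
exact: IH.
Qed.

End ContinuousFieldOps.

Section ContinuousConj.
Variables (C : numClosedFieldType) (T : topologicalType).
Lemma continuous_conjf (f : T -> C^o) : continuous f ->
  continuous (fun x => (f x : C)^* : C^o).
Proof.
move=> cf x; apply/(@cvgrPdist_lt C C^o) => e e0.
have /(@cvgrPdist_lt C C^o) /(_ e e0) := cf x.
by apply: filterS => y; rewrite -rmorphB norm_conjC.
Qed.
End ContinuousConj.

(* The C*-algebra C(K) of continuous functions K -> R[i] with the sup norm. The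
   alias keeps the compact-open topologies of continuousType out of the way;
   R[i] itself carries no topology, (R[i])^o has the one of the modulus. *)
Definition cfun (R : realType) (K : compactSpaceType) :=
  continuousType K (R[i])^o.
HB.instance Definition _ R K :=
  Choice.copy (cfun R K) (continuousType K (R[i])^o).
Definition cfun_fun (R : realType) (K : compactSpaceType) (f : cfun R K) :
  K -> R[i] := f.
Coercion cfun_fun : cfun >-> Funclass.
Definition mkcfun (R : realType) (K : compactSpaceType) (f : K -> R[i])
    (cf : continuous (f : K -> (R[i])^o)) : cfun R K :=
  (mkcts cf : continuousType K (R[i])^o).

Section Cfun.
Variables (R : realType) (K : compactSpaceType).
Local Notation C := R[i].
Local Notation cfun := (cfun R K).
Implicit Types f g h : cfun.

Lemma cfunP f g : (forall x, f x = g x) <-> f = g.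
Proof. by split=> [fg|->//]; apply/continuousEP. Qed.

Lemma cfun_cts f : continuous (f : K -> C^o).
Proof. exact: cts_fun. Qed.

Definition cfun0 : cfun := mkcfun (fun x => @cvg_cst C^o 0 K (nbhs x) _).
Definition cfunD f g : cfun :=
  mkcfun (continuous_addf (@cfun_cts f) (@cfun_cts g)).
Definition cfunN f : cfun := mkcfun (continuous_oppf (@cfun_cts f)).
Lemma cfunZ_cts (k : C) f : continuous (fun x => k * f x : C^o).
Proof.
apply: (@continuous_mulf C K (fun=> k) f); last exact: cfun_cts.
by move=> x; exact: cvg_cst.
Qed.
Definition cfunZ (k : C) f : cfun := mkcfun (@cfunZ_cts k f).
Definition cfunM f g : cfun :=
  mkcfun (continuous_mulf (@cfun_cts f) (@cfun_cts g)).
Definition cfunJ f : cfun := mkcfun (continuous_conjf (@cfun_cts f)).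

Lemma cfun_addA : associative cfunD.
Proof. by move=> f g h; apply/cfunP => x; exact: addrA. Qed.
Lemma cfun_addC : commutative cfunD.
Proof. by move=> f g; apply/cfunP => x; exact: addrC. Qed.
Lemma cfun_add0 : left_id cfun0 cfunD.
Proof. by move=> f; apply/cfunP => x; exact: add0r. Qed.
Lemma cfun_addN : left_inverse cfun0 cfunN cfunD.
Proof. by move=> f; apply/cfunP => x; exact: addNr. Qed.
HB.instance Definition _ := GRing.isZmodule.Build cfun
  cfun_addA cfun_addC cfun_add0 cfun_addN.

Lemma cfun_scaleA k l f : cfunZ k (cfunZ l f) = cfunZ (k * l) f.
Proof. by apply/cfunP => x; exact: mulrA. Qed.
Lemma cfun_scale1 : left_id 1 cfunZ.
Proof. by move=> f; apply/cfunP => x; exact: mul1r. Qed.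
Lemma cfun_scaleDr : right_distributive cfunZ +%R.
Proof. by move=> k f g; apply/cfunP => x; exact: mulrDr. Qed.
Lemma cfun_scaleDl f : {morph cfunZ^~ f : k l / k + l}.
Proof. by move=> k l; apply/cfunP => x; exact: mulrDl. Qed.
HB.instance Definition _ := GRing.Zmodule_isLmodule.Build C cfun
  cfun_scaleA cfun_scale1 cfun_scaleDr cfun_scaleDl.

(* The norm of R[i] is valued in R[i], hence complex.Re and %:C. The supremum
   is 0 when K is empty. *)
Definition cfun_norm f : C :=
  (sup [set complex.Re `|f x| | x in [set: K]])%:C%C.

Lemma normE (z : C) : `|z| = (complex.Re `|z|)%:C%C.
Proof. by rewrite RRe_real // normr_real. Qed.

Lemma Re_norm_ge0 (z : C) : 0 <= complex.Re `|z|.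
Proof. by rewrite -lecR -normE normr_ge0. Qed.

Lemma cfun_bounded f : has_ubound [set complex.Re `|f x| | x in [set: K]].
Proof.
have cn : continuous (fun x => complex.Re `|f x| : R^o).
  move=> x; apply/(@cvgrPdist_lt R R^o) => e e0.
  have e0' : 0 < e%:C%C by rewrite ltcR.
  have /(@cvgrPdist_lt C C^o) /(_ _ e0') := @cfun_cts f x.
  apply: filterS => y; rewrite -ltcR; apply: le_lt_trans.
  have -> (a : R) : `|a|%:C%C = `|a%:C%C| :> C.
    by rewrite normc_def /= expr0n /= addr0 sqrtr_sqr.
  by rewrite rmorphB /= -!normE; exact: ler_dist_dist.
have /(@compact_bounded R R^o) :
    compact [set complex.Re `|f x| | x in [set: K]].
  apply: (@continuous_compact K R^o); last exact: compact_setT.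
  exact: continuous_subspaceT.
case=> M [_ /(_ (M + 1))]; rewrite ltrDl ltr01 => /(_ isT) bM.
exists (M + 1) => _ [x _ <-].
by rewrite -[X in X <= _]ger0_norm ?Re_norm_ge0 //; apply: bM; exists x.
Qed.

Lemma cfun_le_norm f x : `|f x| <= cfun_norm f.
Proof.
by rewrite normE lecR; apply: ub_le_sup; [exact: cfun_bounded|exists x].
Qed.

Lemma cfun_norm_ge0 f : 0 <= cfun_norm f.
Proof.
rewrite ler0c.
case: (pselect ([set: K] !=set0)) => [[x _]|/set0P/negP/negPn/eqP K0].
  apply: le_trans (ub_le_sup (cfun_bounded f) (_ : _ (complex.Re `|f x|))).
  2: by exists x.
  exact: Re_norm_ge0.
by rewrite K0 image_set0 sup0.
Qed.

Lemma cfun_norm_le f (M : C) : 0 <= M ->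
  (forall x, `|f x| <= M) -> cfun_norm f <= M.
Proof.
move=> M0 fM; rewrite -[M](@RRe_real R) ?ger0_real // lecR.
case: (pselect ([set: K] !=set0)) => [[x0 _]|/set0P/negP/negPn/eqP K0].
  apply: ge_sup; first by exists (complex.Re `|f x0|), x0.
  by move=> _ [x _ <-]; rewrite -lecR -normE RRe_real ?ger0_real.
by rewrite K0 image_set0 sup0 -lecR RRe_real ?ger0_real.
Qed.

Lemma cfun_normD f g : cfun_norm (f + g) <= cfun_norm f + cfun_norm g.
Proof.
apply: cfun_norm_le => [|x]; first by rewrite addr_ge0 ?cfun_norm_ge0.
by rewrite (le_trans (ler_normD _ _)) // lerD ?cfun_le_norm.
Qed.

Lemma cfun_normZ_le (k : C) f : cfun_norm (k *: f) <= `|k| * cfun_norm f.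
Proof.
apply: cfun_norm_le => [|x]; first by rewrite mulr_ge0 ?cfun_norm_ge0.
by rewrite normrM ler_wpM2l ?cfun_le_norm.
Qed.

Lemma cfun_normZ (k : C) f : cfun_norm (k *: f) = `|k| * cfun_norm f.
Proof.
apply/eqP; rewrite eq_le cfun_normZ_le /=.
have [->|k0] := eqVneq k 0; first by rewrite normr0 mul0r cfun_norm_ge0.
rewrite -ler_pdivlMl ?normr_gt0 // -normfV.
by apply: le_trans (cfun_normZ_le _ _); rewrite scalerA mulVf // scale1r.
Qed.

Lemma cfun_norm0_eq0 f : cfun_norm f = 0 -> f = 0.
Proof.
move=> f0; apply/cfunP => x; apply/eqP.
by rewrite -normr_le0 -[X in _ <= X]f0 cfun_le_norm.
Qed.

HB.instance Definition _ := @Lmodule_isNormed.Build C cfun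
  cfun_norm cfun_normD cfun_normZ cfun_norm0_eq0.

Lemma cfun_normE f : `|f| = cfun_norm f. Proof. by []. Qed.

Lemma cfun_distE f g x : `|f x - g x| <= `|f - g|.
Proof. exact: (cfun_le_norm (f - g)). Qed.


Lemma Re_dist (z w : C) : `|complex.Re z - complex.Re w|%:C%C <= `|z - w|.
Proof.
by case: z w => [a b] [c d]; exact: (normc_ge_Re (Complex a b - Complex c d)).
Qed.

Lemma Im_dist (z w : C) : `|complex.Im z - complex.Im w|%:C%C <= `|z - w|.
Proof.
case: z w => [a b] [c d]; rewrite normc_def lecR /= -sqrtr_sqr.
by rewrite ler_sqrt ?addr_ge0 ?sqr_ge0 // lerDr sqr_ge0.
Qed.

Lemma norm_le_ReIm (z : C) :
  `|z| <= (`|complex.Re z| + `|complex.Im z|)%:C%C.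
Proof.
case: z => a b /=; rewrite normc_def lecR /=.
have h0 : 0 <= `|a| + `|b| by rewrite addr_ge0.
rewrite -[leRHS]ger0_norm // -sqrtr_sqr ler_sqrt ?sqr_ge0 //.
rewrite sqrrD !real_normK ?num_real // addrAC lerDl.
by rewrite mulrn_wge0 // mulr_ge0.
Qed.

Lemma real_cauchy_cvg (F : set_system cfun) (p : cfun -> R) :
  ProperFilter F -> cauchy F ->
  (forall f g, `|p f - p g|%:C%C <= `|f - g|) ->
  {l : R | forall e f, 0 < e -> F (ball f e) -> `|p f - l|%:C%C <= e *+ 2}.
Proof.
move=> FF Fc pl; apply: cid.
have pF : cauchy (p @ F).
  apply: cauchy_exP => e e0.
  have e0' : 0 < e%:C%C by rewrite ltcR.
  have [f Ff] := (iffLR (cauchyP F) Fc) _ e0'.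
  exists (p f).
  apply: (@filterS _ F _ (ball f e%:C%C) (p @^-1` ball (p f) e) _ Ff) => g fg.
  suff : `|p f - p g| < e by [].
  by rewrite -ltcR; apply: le_lt_trans (pl _ _) _; exact: fg.
have /cvg_ex[l pl_] := R_complete (fmap_proper_filter p FF) pF.
exists l => e f e0 Ff.
have er : e = (complex.Re e)%:C%C by rewrite RRe_real // gtr0_real.
have re0 : 0 < complex.Re e by rewrite -ltcR -er.
have /(@cvgrPdist_lt R R^o) /(_ _ re0) nl := pl_.
have [g [fg lg]] := filter_ex (filterI Ff nl).
rewrite [in leRHS]er -rmorphMn lecR.
rewrite (le_trans (ler_distD (p g) _ _)) // mulr2n lerD //; last first.
  by rewrite distrC ltW.
by rewrite -lecR -er; apply: le_trans (pl _ _) (ltW _).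
Qed.

Lemma cfun_complete (F : set_system cfun) :
  ProperFilter F -> cauchy F -> cvg F.
Proof.
move=> FF Fc.
have hRe x : forall f g : cfun,
    `|complex.Re (f x) - complex.Re (g x)|%:C%C <= `|f - g|.
  by move=> f g; apply: le_trans (Re_dist _ _) (cfun_distE _ _ _).
have hIm x : forall f g : cfun,
    `|complex.Im (f x) - complex.Im (g x)|%:C%C <= `|f - g|.
  by move=> f g; apply: le_trans (Im_dist _ _) (cfun_distE _ _ _).
pose g (x : K) : C := Complex (sval (real_cauchy_cvg FF Fc (hRe x)))
                              (sval (real_cauchy_cvg FF Fc (hIm x))).
have gP e f x : 0 < e -> F (ball f e) -> `|g x - f x| <= e *+ 4.
  move=> e0 Ff; rewrite distrC (le_trans (norm_le_ReIm _)) // rmorphD /=.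
  have -> : e *+ 4 = e *+ 2 + e *+ 2 by rewrite -mulrnDr.
  rewrite /g; case: real_cauchy_cvg => a /= /(_ e f e0 Ff) ha.
  case: real_cauchy_cvg => b /= /(_ e f e0 Ff) hb.
  by move: ha hb; case: (f x) => u v ha hb; exact: lerD.
have cg : continuous (g : K -> C^o).
  move=> x; apply/(@cvgrPdist_lt C C^o) => e e0.
  have e90 : 0 < e / 9%:R by rewrite divr_gt0 ?ltr0n.
  have [f Ff] := (iffLR (cauchyP F) Fc) _ e90.
  have /(@cvgrPdist_lt C C^o) /(_ _ e90) := @cfun_cts f x.
  apply: filterS => y fxy.
  rewrite (le_lt_trans (ler_distD (f x) _ _)) //.
  have -> : e = (e / 9%:R) *+ 4 + (e / 9%:R) *+ 5.
    by rewrite -mulrnDr -[(4 + 5)%N]/9%N -[RHS]mulr_natr divfK // pnatr_eq0.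
  rewrite ler_ltD //; first exact: gP.
  rewrite (le_lt_trans (ler_distD (f y) _ _)) // mulrS ltr_leD //.
  by rewrite distrC; exact: gP.
apply/cvg_ex; exists (mkcfun cg).
apply/(@cvgrPdist_lt C cfun) => e e0.
have e50 : 0 < e / 5%:R by rewrite divr_gt0 ?ltr0n.
have [f Ff] := (iffLR (cauchyP F) Fc) _ e50.
apply: filterS (Ff) => h fh.
have -> : e = (e / 5%:R) *+ 4 + (e / 5%:R).
  by rewrite -mulrSr -[RHS]mulr_natr divfK // pnatr_eq0.
rewrite (le_lt_trans (ler_distD f _ _)) // ler_ltD //.
apply: cfun_norm_le => [|x]; first by rewrite mulrn_wge0 ?ltW.
exact: (gP _ f x).
Qed.

HB.instance Definition _ := @Uniform_isComplete.Build cfun cfun_complete.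

End Cfun.

Section CfunCStar.
Variables (R : realType) (K : compactSpaceType).
Implicit Types f g h : cfun R K.

Lemma cfun_mulA : associative (@cfunM R K).
Proof. by move=> f g h; apply/cfunP => x; exact: mulrA. Qed.
Lemma cfun_mulDl : left_distributive (@cfunM R K) +%R.
Proof. by move=> f g h; apply/cfunP => x; exact: mulrDl. Qed.
Lemma cfun_mulDr : right_distributive (@cfunM R K) +%R.
Proof. by move=> f g h; apply/cfunP => x; exact: mulrDr. Qed.
Lemma cfun_mulZl (k : R[i]) f g : cfunM (k *: f) g = k *: cfunM f g.
Proof. by apply/cfunP => x; exact: esym (mulrA _ _ _). Qed.
Lemma cfun_mulZr (k : R[i]) f g : cfunM f (k *: g) = k *: cfunM f g.
Proof. by apply/cfunP => x; exact: mulrCA. Qed.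
Lemma cfun_starK : involutive (@cfunJ R K).
Proof. by move=> f; apply/cfunP => x; exact: conjCK. Qed.
Lemma cfun_starD : {morph @cfunJ R K : f g / f + g}.
Proof. by move=> f g; apply/cfunP => x; exact: rmorphD. Qed.
Lemma cfun_starZ (k : R[i]) f : cfunJ (k *: f) = k^* *: cfunJ f.
Proof. by apply/cfunP => x; exact: rmorphM. Qed.
Lemma cfun_starM f g : cfunJ (cfunM f g) = cfunM (cfunJ g) (cfunJ f).
Proof. by apply/cfunP => x; rewrite -[RHS]mulrC; exact: rmorphM. Qed.
Lemma cfun_norm_mul f g : `|cfunM f g| <= `|f| * `|g|.
Proof.
apply: cfun_norm_le => [|x]; first exact: mulr_ge0.
by rewrite normrM ler_pM // ?cfun_le_norm.
Qed.
Lemma cfun_norm_star_mul f : `|cfunM (cfunJ f) f| = `|f| ^+ 2.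
Proof.
have E x : `|cfunM (cfunJ f) f x| = `|f x| ^+ 2.
  by rewrite normrM norm_conjC -expr2.
apply/eqP; rewrite eq_le; apply/andP; split.
  apply: cfun_norm_le => [|x]; first exact: exprn_ge0.
  by rewrite E lerXn2r ?nnegrE ?normr_ge0 ?cfun_norm_ge0 ?cfun_le_norm.
rewrite -[leRHS]sqrtCK lerXn2r ?nnegrE ?normr_ge0 ?sqrtC_ge0 //.
apply: cfun_norm_le => [|x]; first by rewrite sqrtC_ge0.
rewrite -[leLHS]sqrCK ?normr_ge0 // ler_sqrtC ?qualifE /= ?exprn_ge0 //.
by rewrite -E; exact: cfun_le_norm.
Qed.

HB.instance Definition _ := @isCStarAlgebra.Build R (cfun R K)
  (@cfunM R K) (@cfunJ R K) cfun_mulA cfun_mulDl cfun_mulDr cfun_mulZl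
  cfun_mulZr cfun_starK cfun_starD cfun_starZ cfun_starM cfun_norm_mul
  cfun_norm_star_mul.

End CfunCStar.

Section Untag.
Variables (I : finType) (X : I -> topologicalType) (Z : topologicalType).

Lemma continuous_sigT (f : {i & X i} -> Z) :
  (forall i, continuous (fun x : X i => f (existT _ i x))) ->
  continuous f.
Proof.
by move=> cf [i x] U nU; apply: existT_continuous; exact: cf.
Qed.

Lemma continuous_untag (z : Z) i (F : X i -> Z) :
  continuous F -> continuous (untag z F).
Proof.
move=> cF; apply: continuous_sigT => j.
have [ij|ij] := eqVneq j i.
  subst j.
  have -> : (fun x => @untag I X Z z i F (existT X i x)) = F.
    by apply/funext => x; rewrite (@untagE I X Z z i F (existT X i x) erefl).
  exact: cF.
have -> : (fun x => @untag I X Z z i F (existT X j x)) = (fun=> z).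
  by apply/funext => x; rewrite untag_dflt.
by move=> x; exact: cvg_cst.
Qed.

End Untag.

Section MauldinWilliamsCorrespondence.
Variables (R : realType) (G : graph) (M : mauldin_williams R G).
Local Notation C := R[i].

Definition mw_total : compactSpaceType := {v : vertex G & mw_space M v}.

(* E x_G T, a pair (e, x) with x in T_(r e) being existT _ e x. *)
Definition mw_edge_total : compactSpaceType :=
  {e : edge G & mw_space M (rng e)}.

Local Notation A := (cfun R mw_total).
Local Notation X := (cfun R mw_edge_total).
Implicit Types (a b : A) (xi eta zeta : X).

Definition mw_point e (x : mw_space M (rng e)) : mw_edge_total :=
  existT (fun e => mw_space M (rng e) : Type) e x.
Definition mw_rng_point (p : mw_edge_total) : mw_total :=
  existT (fun v => mw_space M v : Type) (rng (tag p)) (tagged p).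
Definition mw_src_point (p : mw_edge_total) : mw_total :=
  existT (fun v => mw_space M v : Type) (src (tag p)) (mw_map (tagged p)).

Lemma mw_rng_point_continuous : continuous mw_rng_point.
Proof. by apply: continuous_sigT => e x; exact: existT_continuous. Qed.

Lemma mw_map_continuous e : continuous (@mw_map R G M e).
Proof.
have [c [/andP[c0 c1] Hc]] := mw_contraction M.
move=> x; apply/cvg_ballP => d d0.
have: \forall y \near x, ball x d y by exact: nbhsx_ballx.
apply: filterS => y; rewrite !ballEmdist /= => xy.
apply: le_lt_trans (Hc _ _ _) (le_lt_trans _ xy).
by rewrite ler_piMl ?mdist_ge0 // ltW.
Qed.

Lemma mw_src_point_continuous : continuous mw_src_point.
Proof.
apply: continuous_sigT => e x.
apply: (@continuous_comp _ _ mw_total (@mw_map R G M e)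
         (existT (fun v => mw_space M v : Type) (src e))).
  exact: mw_map_continuous.
exact: existT_continuous.
Qed.

Lemma mw_ract_continuous xi a :
  continuous (fun p => xi p * a (mw_rng_point p) : C^o).
Proof.
apply: (continuous_mulf (@cfun_cts _ _ xi)) => p.
apply: (@continuous_comp _ _ _ mw_rng_point (a : _ -> C^o)).
  exact: mw_rng_point_continuous.
exact: cfun_cts.
Qed.

Definition mw_ract xi a : X := mkcfun (@mw_ract_continuous xi a).

Lemma mw_lact_continuous a xi :
  continuous (fun p => a (mw_src_point p) * xi p : C^o).
Proof.
apply: (fun h => continuous_mulf h (@cfun_cts _ _ xi)) => p.
apply: (@continuous_comp _ _ _ mw_src_point (a : _ -> C^o)).
  exact: mw_src_point_continuous.
exact: cfun_cts.
Qed.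

Definition mw_lact a xi : X := mkcfun (@mw_lact_continuous a xi).

(* untag 0 F p is F x if p = (rng e, x), and 0 if the component of p is not
   T_(r e): this is the sum over the edges e with x in T_(r e). *)
Definition mw_inner_fun xi eta (p : mw_total) : C :=
  \sum_(e : edge G)
    untag 0 (fun x : mw_space M (rng e) =>
               (xi (mw_point x))^* * eta (mw_point x)) p.

Lemma mw_inner_continuous xi eta : continuous (mw_inner_fun xi eta : _ -> C^o).
Proof.
apply: continuous_sumf => e; apply: continuous_untag.
have ct (f : X) : continuous (fun x => f (@mw_point e x) : C^o).
  move=> x.
  apply: (@continuous_comp _ mw_edge_total _ (@mw_point e) (f : _ -> C^o)).
    exact: existT_continuous.
  exact: cfun_cts.
by apply: continuous_mulf => //; apply: continuous_conjf.
Qed.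

Definition mw_inner xi eta : A := mkcfun (@mw_inner_continuous xi eta).

End MauldinWilliamsCorrespondence.

Section UntagCases.
Variables (I : finType) (X : I -> topologicalType) (Z : Type).

Lemma untag_cases (z : Z) i (p : {i & X i}) :
  (exists2 x : X i, p = existT X i x & forall F : X i -> Z, untag z F p = F x)
  \/ (forall F : X i -> Z, untag z F p = z).
Proof.
case: p => j x; have [ji|ji] := eqVneq j i.
  subst j; left; exists x => // F.
  by rewrite (@untagE I X Z z i F (existT X i x) erefl).
by right=> F; rewrite untag_dflt.
Qed.

End UntagCases.

Lemma continuous_sqrt_Re (R : realType) (T : topologicalType) (f : T -> R[i]) :
  continuous (f : T -> (R[i])^o) ->
  continuous (fun x => (Num.sqrt (complex.Re (f x)))%:C%C : (R[i])^o).
Proof.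
move=> cf.
have cr : continuous (fun x => complex.Re (f x) : R^o).
  move=> x; apply/(@cvgrPdist_lt R R^o) => e e0.
  have e0' : 0 < e%:C%C by rewrite ltcR.
  have /(@cvgrPdist_lt _ (R[i])^o) /(_ _ e0') := cf x.
  apply: filterS => y fxy; rewrite -ltcR.
  exact: le_lt_trans (Re_dist _ _) fxy.
have cs : continuous (fun x => Num.sqrt (complex.Re (f x)) : R^o).
  move=> x; apply: (@continuous_comp T R^o R^o
           (fun x => complex.Re (f x)) Num.sqrt).
    exact: cr.
  exact: sqrt_continuous.
move=> x; apply/(@cvgrPdist_lt _ (R[i])^o) => e e0.
have er : e = (complex.Re e)%:C%C by rewrite RRe_real // gtr0_real.
have re0 : 0 < complex.Re e by rewrite -ltcR -er.
have /(@cvgrPdist_lt R R^o) /(_ _ re0) := cs x.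
apply: filterS => y; rewrite -ltcR -er; apply: le_lt_trans.
by rewrite -rmorphB normc_def /= expr0n /= addr0 sqrtr_sqr.
Qed.

Section MauldinWilliamsAxioms.
Variables (R : realType) (G : graph) (M : mauldin_williams R G).
Local Notation C := R[i].
Local Notation A := (cfun R (mw_total M)).
Local Notation X := (cfun R (mw_edge_total M)).
Implicit Types (a b : A) (x y z : X).

Lemma mw_ract_linearl (k : C) x y a :
  mw_ract (k *: x + y) a = k *: mw_ract x a + mw_ract y a.
Proof. by apply/cfunP => p; rewrite [LHS]mulrDl -mulrA. Qed.

Lemma mw_ract_linearr (k : C) x a b :
  mw_ract x (k *: a + b) = k *: mw_ract x a + mw_ract x b.
Proof. by apply/cfunP => p; rewrite [LHS]mulrDr mulrCA. Qed.

Lemma mw_ractM x a b : mw_ract x (a ** b) = mw_ract (mw_ract x a) b.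
Proof. by apply/cfunP => p; exact: mulrA. Qed.

Lemma mw_inner_linear (k : C) x y z :
  mw_inner x (k *: y + z) = k *: mw_inner x y + mw_inner x z.
Proof.
apply/cfunP => p.
rewrite -[RHS]/(k * mw_inner_fun x y p + mw_inner_fun x z p).
rewrite /mw_inner_fun mulr_sumr -big_split; apply: eq_bigr => e _ /=.
have [[t _ E]|E] := untag_cases (0 : C) (rng e) p; rewrite !E.
  by rewrite mulrCA -mulrDr.
by rewrite mulr0 addr0.
Qed.

Lemma mw_inner_ract x y a : mw_inner x (mw_ract y a) = mw_inner x y ** a.
Proof.
apply/cfunP => p; rewrite -[RHS]/(mw_inner_fun x y p * a p).
rewrite -[LHS]/(mw_inner_fun _ _ p).
rewrite /mw_inner_fun mulr_suml; apply: eq_bigr => e _ /=.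
have [[t -> E]|E] := untag_cases (0 : C) (rng e) p; rewrite !E.
  by rewrite -mulrA.
by rewrite mul0r.
Qed.

Lemma mw_star_inner x y : star (mw_inner x y) = mw_inner y x.
Proof.
apply/cfunP => p; rewrite -[LHS]/((mw_inner_fun x y p)^*).
rewrite -[RHS]/(mw_inner_fun _ _ p).
rewrite /mw_inner_fun rmorph_sum; apply: eq_bigr => e _ /=.
have [[t _ E]|E] := untag_cases (0 : C) (rng e) p; rewrite !E.
  by rewrite [LHS]rmorphM /= mulrC; congr (_ * _); rewrite conjCK.
by rewrite conjC0.
Qed.

Lemma mw_inner_term_ge0 x (p : mw_total M) e :
  0 <= untag 0 (fun t : mw_space M (rng e) =>
                  (x (mw_point t))^* * x (mw_point t)) p.
Proof.
have [[t _ E]|E] := untag_cases (0 : C) (rng e) p; rewrite E //.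
by rewrite mulrC mul_conjC_ge0.
Qed.

Lemma mw_inner_ge0 x p : 0 <= mw_inner x x p.
Proof. by apply: sumr_ge0 => e _; exact: mw_inner_term_ge0. Qed.

Lemma mw_inner_positive x : exists b, mw_inner x x = star b ** b.
Proof.
exists (mkcfun (continuous_sqrt_Re (@cfun_cts _ _ (mw_inner x x)))).
apply/cfunP => p; set r := complex.Re (mw_inner x x p).
have xr : mw_inner x x p = r%:C%C.
  by rewrite RRe_real // ger0_real ?mw_inner_ge0.
have r0 : 0 <= r by rewrite -lecR -xr mw_inner_ge0.
rewrite xr -[RHS]/(((Num.sqrt r)%:C%C)^* * (Num.sqrt r)%:C%C).
rewrite conj_Creal; first by rewrite -rmorphM -expr2 sqr_sqrtr.
by apply/complex_realP; exists (Num.sqrt r).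
Qed.

Lemma mw_point_le x e (t : mw_space M (rng e)) :
  `|x (mw_point t)| ^+ 2 <= mw_inner x x (mw_rng_point (mw_point t)).
Proof.
rewrite -[leRHS]/(mw_inner_fun x x _) /mw_inner_fun (bigD1 e) //=.
set F := fun t : mw_space M (rng e) => _.
have -> : untag 0 F (mw_rng_point (mw_point t)) = F t.
  exact: (@untagE _ (fun v => mw_space M v : Type) C 0 (rng e) F
           (mw_rng_point (mw_point t)) erefl).
rewrite /F normCK mulrC lerDl; apply: sumr_ge0 => e' _.
exact: mw_inner_term_ge0.
Qed.

Lemma mw_norm_le x : `|x| <= sqrtC `|mw_inner x x|.
Proof.
apply: cfun_norm_le => [|[e t]]; first by rewrite sqrtC_ge0.
rewrite -[leLHS]sqrCK ?normr_ge0 // ler_sqrtC ?qualifE /= ?exprn_ge0 //.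
apply: le_trans (mw_point_le _ _) _.
by rewrite -[leLHS]ger0_norm ?mw_inner_ge0 // cfun_le_norm.
Qed.

Lemma mw_inner_definite x : mw_inner x x = 0 -> x = 0.
Proof.
move=> x0; apply/eqP; rewrite -normr_le0.
by apply: le_trans (mw_norm_le x) _; rewrite x0 normr0 sqrtC0.
Qed.

Lemma mw_inner_norm_le x : `|mw_inner x x| <= #|edge G|%:R * `|x| ^+ 2.
Proof.
apply: cfun_norm_le => [|p]; first by rewrite mulr_ge0 ?ler0n ?exprn_ge0.
rewrite mulr_natl -sumr_const; apply: le_trans (ler_norm_sum _ _ _) _.
apply: ler_sum => e _.
have [[t _ E]|E] := untag_cases (0 : C) (rng e) p; rewrite E.
  rewrite normrM norm_conjC -expr2 lerXn2r ?nnegrE ?normr_ge0 //.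
  exact: cfun_le_norm.
by rewrite normr0 exprn_ge0.
Qed.

Lemma mw_complete (u : nat -> X) :
  (forall e : C, 0 < e -> exists N : nat, forall m n : nat,
     (N <= m)%N -> (N <= n)%N ->
     sqrtC `|mw_inner (u m - u n) (u m - u n)| < e) ->
  exists x, forall e : C, 0 < e -> exists N : nat, forall n : nat,
     (N <= n)%N -> sqrtC `|mw_inner (u n - x) (u n - x)| < e.
Proof.
move=> uc.
have uF : cauchy (u @ \oo).
  apply: cauchy_exP => e e0; have [N uN] := uc _ e0.
  exists (u N); exists N => // n /= Nn.
  rewrite -ball_normE /=; apply: le_lt_trans (mw_norm_le _) _; exact: uN.
have : cvg (u @ \oo) by apply: cauchy_cvg uF.
move=> /cvg_ex[x ux].
exists x => e e0; set q := sqrtC (#|edge G|%:R : C).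
have q0 : 0 <= q by rewrite sqrtC_ge0 ler0n.
have q1 : 0 < q + 1 by rewrite ltr_wpDl.
have e1 : 0 < e / (q + 1) by rewrite divr_gt0.
have /(@cvgrPdist_lt C X) /(_ _ e1)[N _ uN] := ux.
exists N => n Nn; have {}uN : `|u n - x| < e / (q + 1) by rewrite distrC uN.
apply: (@le_lt_trans _ _ (q * `|u n - x|)).
  rewrite -[leRHS]sqrCK ?mulr_ge0 //.
  rewrite ler_sqrtC ?qualifE /= ?exprn_ge0 ?mulr_ge0 //.
  by rewrite exprMn sqrtCK mw_inner_norm_le.
apply: (@le_lt_trans _ _ ((q + 1) * `|u n - x|)).
  by rewrite ler_wpM2r // lerDl.
by rewrite mulrC -ltr_pdivlMr.
Qed.

Lemma mw_lact_linear (k : C) a b x :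
  mw_lact (k *: a + b) x = k *: mw_lact a x + mw_lact b x.
Proof. by apply/cfunP => p; rewrite [LHS]mulrDl -mulrA. Qed.

Lemma mw_lactM a b x : mw_lact (a ** b) x = mw_lact a (mw_lact b x).
Proof. by apply/cfunP => p; exact: esym (mulrA _ _ _). Qed.

Lemma mw_lact_adjoint a x y :
  mw_inner (mw_lact a x) y = mw_inner x (mw_lact (star a) y).
Proof.
apply/cfunP => p.
rewrite -[RHS]/(mw_inner_fun _ _ p) -[LHS]/(mw_inner_fun _ _ p).
apply: eq_bigr => e _ /=.
have [[t _ E]|E] := untag_cases (0 : C) (rng e) p; rewrite !E //.
set q := mw_point t.
rewrite -[LHS]/((a (mw_src_point q) * x q)^* * y q).
rewrite -[RHS]/((x q)^* * ((a (mw_src_point q))^* * y q)).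
by rewrite rmorphM -mulrA mulrCA.
Qed.

Definition mw_correspondence : correspondence A := Correspondence
  mw_ract_linearl mw_ract_linearr mw_ractM mw_inner_linear mw_inner_ract
  mw_star_inner mw_inner_positive mw_inner_definite mw_complete mw_lact_linear
  mw_lactM mw_lact_adjoint.

End MauldinWilliamsAxioms.

(* Main.v *)
Require Import Defs.
From mathcomp Require Import all_boot all_order all_algebra.
From mathcomp Require Import all_classical all_reals all_analysis.
From mathcomp Require Import complex.

(* Since E x_G T is a disjoint union over the edges, X has the finite frame of
   the indicators d_e of {e} x T_(r e): x = sum_e d_e <d_e, x>. Hence every
   adjointable operator on X is compact, and a Toeplitz representation
   (psi, pi) is covariant iff pi a = sum_e psi (a d_e) psi(d_e)^*, that is
     pi a = sum_e S_e pi(a o phi_e) S_e^*   with S_e = psi(d_e).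
   For any Cuntz-Krieger family (P, S), the right-hand side is an operator on
   the *-homomorphisms pi : C(T) -> B with pi(1_v) = P_v. Iterating it n times
   evaluates a along the maps phi_w, w a path of length n, whose images have
   diameter O(c^n); so any two such pi become close on a, and there is exactly
   one fixed point. Existence of the fixed point in C^*(G) gives the map
   O_X -> C^*(G), and its uniqueness in O_X shows that the canonical map
   C^*(G) -> O_X is a two-sided inverse.

   Two facts on C^*-algebras are obtained without spectral theory, from the
   remark that if h and d commute, are selfadjoint and h^2 + d^2 = 1, then
   h + i d is unitary and |h| <= 1: *-homomorphisms are contractive, and
   projections whose sum is a projection are orthogonal. *)

Set Implicit Arguments.
Unset Strict Implicit.
Unset Printing Implicit Defensive.
Import Order.TTheory GRing.Theory Num.Theory.
Import numFieldNormedType.Exports.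
Local Open Scope classical_set_scope.
Local Open Scope ring_scope.

(** * Arithmetic and continuity in C*-algebras *)

Lemma bounded_additive_continuous (K : numFieldType) (V W : normedModType K)
    (f : V -> W) (k : K) :
  {morph f : x y / x - y} -> 0 <= k -> (forall x, `|f x| <= k * `|x|) ->
  continuous f.
Proof.
move=> fB k0 fk x; apply/(@cvgrPdist_lt K W) => e e0.
have k1 : 0 < k + 1 by rewrite ltr_wpDl.
have ek : 0 < e / (k + 1) by rewrite divr_gt0.
have /(@cvgrPdist_lt K V) /(_ _ ek) := @cvg_id _ (nbhs x).
apply: filterS => y xy; rewrite -fB (le_lt_trans (fk _)) //.
apply: (@le_lt_trans _ _ ((k + 1) * `|x - y|)).
  by rewrite ler_wpM2r // lerDl.
by rewrite mulrC -ltr_pdivlMr.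
Qed.

Lemma closed_equalizer (K : numFieldType) (V W : normedModType K)
    (f g : V -> W) :
  continuous f -> continuous g -> closed [set x | f x = g x].
Proof.
move=> cf cg.
have -> : [set x | f x = g x] = (fun x => f x - g x) @^-1` [set 0].
  apply/seteqP; split=> x /=; first by move=> ->; rewrite subrr.
  by move/eqP; rewrite subr_eq0 => /eqP.
apply: preimage_closed.
  by move=> x _; apply: cvgB; [exact: cf|exact: cg].
exact/accessible_closed_set1/hausdorff_accessible/norm_hausdorff.
Qed.

Lemma cauchy_seq_cvg (K : numFieldType) (V : completeNormedModType K)
    (u : nat -> V) :
  (forall e, 0 < e -> exists N, forall n, (N <= n)%N -> `|u N - u n| < e) ->
  exists l : V, u @ \oo --> l.
Proof.
move=> uc; suff: cvg (u @ \oo) by move=> /cvg_ex.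
have uF : cauchy (u @ \oo).
  apply: cauchy_exP => e e0; have [N uN] := uc _ e0.
  by exists (u N); exists N => // n /= Nn; rewrite -ball_normE /=; exact: uN.
exact: cauchy_cvg uF.
Qed.

Section CStarArithmetic.
Variables (R : realType) (B : cstarAlgType R).
Local Notation C := R[i].
Implicit Types (a b x y : B) (k : C).

Lemma cmul0l b : 0 ** b = 0 :> B.
Proof. by apply: (addIr (0 ** b)); rewrite -cmulDl !add0r. Qed.
Lemma cmul0r b : b ** 0 = 0 :> B.
Proof. by apply: (addIr (b ** 0)); rewrite -cmulDr !add0r. Qed.
Lemma cmulNl a b : (- a) ** b = - (a ** b).
Proof. by apply: (addIr (a ** b)); rewrite -cmulDl !addNr cmul0l. Qed.
Lemma cmulNr a b : a ** (- b) = - (a ** b).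
Proof. by apply: (addIr (a ** b)); rewrite -cmulDr !addNr cmul0r. Qed.
Lemma cmulBl a b x : (a - b) ** x = a ** x - b ** x.
Proof. by rewrite cmulDl cmulNl. Qed.
Lemma cmulBr a b x : x ** (a - b) = x ** a - x ** b.
Proof. by rewrite cmulDr cmulNr. Qed.
Lemma star0 : star 0 = 0 :> B.
Proof. by apply: (addIr (star 0)); rewrite -starD !add0r. Qed.
Lemma starN a : star (- a) = - star a.
Proof. by apply: (addIr (star a)); rewrite -starD !addNr star0. Qed.
Lemma starB a b : star (a - b) = star a - star b.
Proof. by rewrite starD starN. Qed.

Lemma cmul_suml (I : Type) (r : seq I) (P : pred I) (F : I -> B) b :
  (\sum_(i <- r | P i) F i) ** b = \sum_(i <- r | P i) F i ** b.
Proof.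
by apply: (big_morph (fun x => x ** b)) => [x y|]; rewrite ?cmulDl ?cmul0l.
Qed.
Lemma cmul_sumr (I : Type) (r : seq I) (P : pred I) (F : I -> B) b :
  b ** (\sum_(i <- r | P i) F i) = \sum_(i <- r | P i) b ** F i.
Proof.
by apply: (big_morph (fun x => b ** x)) => [x y|]; rewrite ?cmulDr ?cmul0r.
Qed.
Lemma star_sum (I : Type) (r : seq I) (P : pred I) (F : I -> B) :
  star (\sum_(i <- r | P i) F i) = \sum_(i <- r | P i) star (F i).
Proof. by apply: (big_morph (@star R B)) => [x y|]; rewrite ?starD ?star0. Qed.

(** The C*-identity gives |x|^2 <= |star x| |x|; the reverse bound comes from replacing x by
    [star x]. *)
Lemma norm_star a : `|star a| = `|a|.
Proof.
suff le x : `|x| <= `|star x|.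
  by apply/eqP; rewrite eq_le le andbT -{2}[a]starK le.
have [->|x0] := eqVneq x 0; first by rewrite normr0.
have x0' : 0 < `|x| by rewrite normr_gt0.
by rewrite -(ler_pM2r x0') -expr2 -norm_star_cmul norm_cmul.
Qed.

Lemma norm_sqr_selfadj a : star a = a -> `|a ** a| = `|a| ^+ 2.
Proof. by move=> sa; rewrite -{1}sa norm_star_cmul. Qed.

Lemma cmul_star_eq0 a : star a ** a = 0 -> a = 0.
Proof.
move=> a0; apply/eqP; rewrite -normr_eq0.
by have := norm_star_cmul a; rewrite a0 normr0 => /esym/eqP; rewrite expf_eq0.
Qed.

Lemma continuous_cmull b : continuous (fun x : B => b ** x).
Proof.
apply: (@bounded_additive_continuous _ _ _ _ `|b|) => // [x y|x].
  exact: cmulBr.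
exact: norm_cmul.
Qed.
Lemma continuous_cmulr b : continuous (fun x : B => x ** b).
Proof.
apply: (@bounded_additive_continuous _ _ _ _ `|b|) => // [x y|x].
  exact: cmulBl.
by rewrite mulrC norm_cmul.
Qed.
Lemma continuous_star : continuous (@star R B).
Proof.
apply: (@bounded_additive_continuous _ _ _ _ 1) => // [x y|x].
  exact: starB.
by rewrite mul1r norm_star.
Qed.

Lemma cvg_cmul (u v : nat -> B) a b : u @ \oo --> a -> v @ \oo --> b ->
  (fun n => u n ** v n) @ \oo --> a ** b.
Proof.
move=> ua vb; apply/(@cvgrPdist_lt _ B) => e e0.
pose d := 1 + `|a| + `|b|.
have d1 : 1 <= d by rewrite /d -addrA lerDl addr_ge0.
have de0 : 0 < d + e by rewrite addr_gt0 // (lt_le_trans ltr01 d1).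
(* As [r <= 1], [u n] has norm at most [|a| + 1], so the total error is at most [r * d < e]. *)
pose r := e / (d + e).
have r0 : 0 < r by rewrite divr_gt0.
have r1 : r <= 1.
  by rewrite ler_pdivrMr // mul1r lerDr (le_trans ler01 d1).
have /(@cvgrPdist_lt _ B) /(_ _ r0) hu := ua.
have /(@cvgrPdist_lt _ B) /(_ _ r0) hv := vb.
apply: filterS2 hu hv => n hu hv.
have -> : a ** b - u n ** v n = (a - u n) ** b + u n ** (b - v n).
  by rewrite cmulBl cmulBr addrA subrK.
have un : `|u n| <= `|a| + 1.
  have -> : u n = a - (a - u n) by rewrite opprB addrC subrK.
  by rewrite (le_trans (ler_normB _ _)) // lerD2l (le_trans (ltW hu)).
apply: le_lt_trans (ler_normD _ _) _.
apply: (@le_lt_trans _ _ (r * `|b| + (`|a| + 1) * r)).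
  rewrite lerD // (le_trans (norm_cmul _ _)) //.
    by rewrite ler_wpM2r // ltW.
  by rewrite ler_pM // ltW.
rewrite [X in _ + X]mulrC -mulrDr [X in r * X]addrCA addrC.
rewrite -[X in r * X]/(_ : C) /r mulrAC ltr_pdivrMr // ltr_pM2l //.
have -> : `|b| + 1 + `|a| = d by rewrite /d addrC addrA addrAC [`|a| + _]addrC.
by rewrite ltrDl.
Qed.

End CStarArithmetic.

(** * Square roots without a unit, and the norm bounds they give *)

Section Contractions.
Variables (R : realType) (B : cstarAlgType R).
Local Notation C := R[i].
Implicit Types (a b c h k q x y : B).

Lemma expr_lt_eps (r e : R) : 0 <= r -> r < 1 -> 0 < e ->
  exists n, r ^+ n < e.
Proof.
move=> r0 r1 e0; have rn : `|r| < 1 by rewrite ger0_norm.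
have /(@cvgrPdist_lt R R^o) /(_ _ e0)[N _ /(_ N (leqnn N))] := cvg_expr rn.
by rewrite sub0r normrN ger0_norm ?exprn_ge0 // => ?; exists N.
Qed.

Lemma exprC_lt_eps (r e : C) : 0 <= r -> r < 1 -> 0 < e ->
  exists n, r ^+ n < e.
Proof.
move=> r0 r1 e0.
have rE : r = (complex.Re r)%:C%C by rewrite RRe_real // ger0_real.
have eE : e = (complex.Re e)%:C%C by rewrite RRe_real // gtr0_real.
move: r0 r1 e0; rewrite rE eE lecR -[1]/(1%:C%C) !ltcR => r0 r1 e0.
by have [n hn] := expr_lt_eps r0 r1 e0; exists n; rewrite -rmorphXn ltcR.
Qed.

(* [1 - c] is a square root of [1 - h]; stated without a unit. *)
Lemma quasi_sqrt h : `|h| < 1 ->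
  exists c, c + c = h + c ** c /\
    forall D : set B, closed D -> D 0 ->
      (forall x, D x -> D (2^-1 *: (h + x ** x))) -> D c.
Proof.
(* [c] is the limit of the iterates of [T] from 0: [T] preserves the ball of radius [r = |h| < 1]
   and contracts it by the factor [r]. The iterates stay in any [D] as in the statement, hence so
   does the limit. *)
move=> h1; pose T x : B := 2^-1 *: (h + x ** x).
pose u n := iter n T 0; pose r : C := `|h|.
have r0 : 0 <= r by exact: normr_ge0.
have half (z : C) : 2^-1 * (z + z) = z.
  by rewrite -mulr2n -[z *+ 2]mulr_natl mulKf // pnatr_eq0.
have half0 : 0 <= 2^-1 :> C by rewrite invr_ge0 ler0n.
have nh (x : B) : `|2^-1 *: x| = 2^-1 * `|x|.
  by rewrite normrZ ger0_norm.
have Tr x : `|x| <= r -> `|T x| <= r.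
  move=> xr; rewrite nh -[leRHS]half ler_wpM2l //.
  rewrite (le_trans (ler_normD _ _)) // lerD //.
  rewrite (le_trans (norm_cmul _ _)) // (@le_trans _ _ (r * 1)) //; last first.
    by rewrite mulr1.
  by rewrite ler_pM // (le_trans xr) // ltW.
have TT x y : `|x| <= r -> `|y| <= r -> `|T x - T y| <= r * `|x - y|.
  move=> xr yr; rewrite /T -scalerBr opprD addrACA subrr add0r nh.
  have -> : x ** x - y ** y = x ** (x - y) + (x - y) ** y.
    by rewrite cmulBr cmulBl addrA subrK.
  rewrite -[leRHS]half ler_wpM2l // (le_trans (ler_normD _ _)) //.
  rewrite lerD // (le_trans (norm_cmul _ _)) //; first by rewrite ler_wpM2r.
  by rewrite mulrC ler_wpM2r.
have ur n : `|u n| <= r.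
  by elim: n => [|n IH]; rewrite /u ?normr0 //= -/(u n); exact: Tr.
have uu n m : `|u n - u (n + m)%N| <= r ^+ n.
  elim: n => [|n IH].
    rewrite add0n expr0 sub0r normrN (le_trans (ur _)) // ltW //.
  by rewrite addSn exprS (le_trans (TT _ _ (ur _) (ur _))) // ler_wpM2l.
have [c uc] : exists c : B, u @ \oo --> c.
  apply: cauchy_seq_cvg => e e0; have [N rN] := exprC_lt_eps r0 h1 e0.
  by exists N => n Nn; rewrite -(subnKC Nn) (le_lt_trans (uu _ _)).
have cT : c = T c.
  apply: (@cvg_unique _ (@norm_hausdorff _ B) ((fun n => u n.+1) @ \oo)).
    by move: uc; rewrite -cvg_shiftS; exact.
  by apply: cvgZl_tmp; apply: cvgD; [exact: cvg_cst|exact: cvg_cmul].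
exists c; split.
  by rewrite {1 2}cT /T -scalerDl -[2^-1]mulr1 -mulrDr half scale1r.
move=> D Dc D0 DT; apply: (closed_cvg _ Dc) uc.
by apply: nearW => n; elim: n => // n; exact: DT.
Qed.

(** For [w = a + 'i *: b], commutation gives star w ** w = a^2 + b^2, while 2a = w + star w gives
    |a| <= |w|. *)
Lemma le_norm_sq_sum a b : star a = a -> star b = b -> a ** b = b ** a ->
  `|a| ^+ 2 <= `|a ** a + b ** b|.
Proof.
move=> sa sb ab; pose w := a + 'i *: b.
have sw : star w = a - 'i *: b by rewrite starD starZ sa sb conjCi scaleNr.
have -> : a ** a + b ** b = star w ** w.
  rewrite sw cmulBl !cmulDr !cmulZr !cmulZl ab scalerA -expr2 sqrCi.
  by rewrite scaleN1r opprB addrACA subrr addr0.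
rewrite norm_star_cmul lerXn2r ?nnegrE ?normr_ge0 //.
rewrite -(@ler_pMn2r _ 2) // -[`|a| *+ 2]normrMn mulr2n.
have -> : a + a = w + star w by rewrite sw addrACA subrr addr0.
by rewrite (le_trans (ler_normD _ _)) // norm_star mulr2n.
Qed.

(* In unital terms h^2 + (1 - c)^2 = 1, so that h + i (1 - c) is unitary. *)
Lemma norm_le1_quasi_sqrt h c : star h = h -> star c = c -> h ** c = c ** h ->
  c + c = h ** h + c ** c -> `|h| <= 1.
Proof.
move=> sh sc hc cc; set p := h ** h.
have sp : star p = p by rewrite starM sh.
have cp : p ** c = c ** p by rewrite /p -cmulA hc !cmulA hc.
have sb : star (h - c ** h) = h - c ** h by rewrite starB starM sh sc hc.
have comm : p ** (h - c ** h) = (h - c ** h) ** p.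
  by rewrite cmulBr cmulBl cmulA cp /p !cmulA.
(* This is the unital identity h^2 + (1 - c)^2 = 1 multiplied by h^2, which removes the unit. With
   [le_norm_sq_sum] it yields |h|^4 <= |h|^2. *)
have E : p ** p + (h - c ** h) ** (h - c ** h) = p.
  have ccp : c ** p + c ** p = p ** p + c ** c ** p by rewrite -!cmulDl cc.
  have X1 : h ** (c ** h) = c ** p by rewrite cmulA hc -cmulA.
  have X2 : c ** h ** h = c ** p by rewrite -cmulA.
  have Y : c ** h ** (c ** h) = c ** c ** p by rewrite -!cmulA X1.
  rewrite cmulBl !cmulBr X1 X2 Y opprB addrACA -opprD ccp.
  by rewrite addrCA opprD addNKr addrK.
have := le_norm_sq_sum sp sb comm; rewrite E norm_sqr_selfadj // -exprM.
have [->|h0] := eqVneq `|h| 0; first by rewrite ler01.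
have hp : 0 < `|h| by rewrite lt_def h0 /=.
rewrite -[leRHS]mulr1 -[(2 * 2)%N]/(2 + 2)%N exprD ler_pM2l ?exprn_gt0 //.
by rewrite expr_le1.
Qed.

(** Each property defines a closed set containing 0 and stable under x -> (h + x^2)/2, so the last
    clause of [quasi_sqrt] puts [c] in it. *)
Lemma quasi_sqrt_selfadj h : `|h| < 1 -> star h = h ->
  exists c, [/\ c + c = h + c ** c, star c = c,
    forall k, h ** k = k ** h -> c ** k = k ** c,
    forall k, h ** k = 0 -> c ** k = 0
  & forall q, q ** h = h -> q ** c = c].
Proof.
move=> h1 sh; have [c [ch cD]] := quasi_sqrt h1.
exists c; split=> //.
- apply: (cD [set x | star x = x]).
  + apply: closed_equalizer; [exact: continuous_star|].
    by move=> x; exact: cvg_id.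
  + exact: star0.
  + by move=> x /= xx; rewrite starZ starD starM sh xx fmorphV /= conjC_nat.
- move=> k hk; apply: (cD [set x | x ** k = k ** x]).
  + apply: closed_equalizer; first exact: continuous_cmulr.
    exact: continuous_cmull.
  + by rewrite /= cmul0l cmul0r.
  + move=> x /= xk; rewrite cmulZl cmulZr cmulDl cmulDr hk.
    by rewrite -cmulA xk cmulA xk cmulA.
- move=> k hk; apply: (cD [set x | x ** k = 0]).
  + apply: closed_equalizer; [exact: continuous_cmulr|].
    by move=> x; exact: cvg_cst.
  + by rewrite /= cmul0l.
  + by move=> x /= xk; rewrite cmulZl cmulDl hk -cmulA xk cmul0r addr0 scaler0.
- move=> q qh; apply: (cD [set x | q ** x = x]).
  + apply: closed_equalizer; [exact: continuous_cmull|].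
    by move=> x; exact: cvg_id.
  + by rewrite /= cmul0r.
  + by move=> x /= qx; rewrite cmulZr cmulDr qh cmulA qx.
Qed.

End Contractions.

(** Allows dividing by a number strictly above the expected bound, which places the element in the
    open unit ball where [quasi_sqrt] applies. *)
Lemma ler_forall_gt (F : numFieldType) (x y : F) :
  (forall z, y < z -> x <= z) -> x <= y.
Proof. by move=> h; apply/ler_addgt0Pr => e e0; apply: h; rewrite ltrDl. Qed.

(** * Homomorphisms of C*-algebras and their contractivity *)

Section StarHom.
Variables (R : realType) (A B : cstarAlgType R) (f : A -> B).
Hypothesis hf : star_hom f.
Local Notation C := R[i].

Lemma star_homM a b : f (a ** b) = f a ** f b. Proof. by case: hf. Qed.
Lemma star_hom_star a : f (star a) = star (f a). Proof. by case: hf. Qed.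
Lemma star_homD a b : f (a + b) = f a + f b.
Proof. by case: hf => lf _ _; rewrite -[a]scale1r lf !scale1r. Qed.
Lemma star_hom0 : f 0 = 0.
Proof. by apply: (addIr (f 0)); rewrite -star_homD !add0r. Qed.
Lemma star_homZ k a : f (k *: a) = k *: f a.
Proof. by case: hf => lf _ _; rewrite -[k *: a]addr0 lf star_hom0 addr0. Qed.
Lemma star_homB a b : f (a - b) = f a - f b.
Proof. by rewrite -scaleN1r star_homD star_homZ scaleN1r. Qed.
Lemma star_hom_sum (I : Type) (r : seq I) (P : pred I) (F : I -> A) :
  f (\sum_(i <- r | P i) F i) = \sum_(i <- r | P i) f (F i).
Proof. by apply: (big_morph f) => [x y|]; rewrite ?star_homD ?star_hom0. Qed.

End StarHom.

Lemma star_hom_comp (R : realType) (A B D : cstarAlgType R) (f : A -> B)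
    (g : B -> D) : star_hom f -> star_hom g -> star_hom (g \o f).
Proof.
move=> [lf mf sf] [lg mg sg]; split=> [k a b|a b|a] /=.
- by rewrite lf lg.
- by rewrite mf mg.
- by rewrite sf sg.
Qed.

Section RescalingBounds.
Variables (R : realType) (B : cstarAlgType R).
Local Notation C := R[i].
Implicit Types (a b p q k x y : B).

Lemma star_scale_ge0 (r : C) a : 0 <= r -> star (r *: a) = r *: star a.
Proof. by move=> r0; rewrite starZ conj_Creal // ger0_real. Qed.

Lemma norm_le_rescale a (M : C) : 0 < M -> `|M^-1 *: a| <= 1 -> `|a| <= M.
Proof.
by move=> M0; rewrite normrZ normfV (gtr0_norm M0) ler_pdivrMl // mulr1.
Qed.

Lemma norm_lt_rescale a (M : C) : 0 < M -> `|a| < M -> `|M^-1 *: a| < 1.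
Proof.
by move=> M0 aM; rewrite normrZ normfV (gtr0_norm M0) ltr_pdivrMl // mulr1.
Qed.

Lemma norm_cmul_self_lt1 a : `|a| < 1 -> `|a ** a| < 1.
Proof.
move=> a1; apply: le_lt_trans (norm_cmul _ _) _.
by rewrite mulr_ilt1.
Qed.

End RescalingBounds.

(** For selfadjoint [b] with |b| < 1, [f] carries the solution [c] attached to b^2 to one attached
    to (f b)^2, so |f b| <= 1. Rescaling covers all selfadjoint elements, and the C*-identity the
    rest. *)
Lemma star_hom_contractive (R : realType) (A B : cstarAlgType R) (f : A -> B) :
  star_hom f -> forall a, `|f a| <= `|a|.
Proof.
move=> hf.
have sf a : star a = a -> `|f a| <= `|a|.
  move=> sa; apply: ler_forall_gt => M aM.
  have M0 : 0 < M by exact: le_lt_trans aM.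
  have Mi : 0 <= M^-1 by rewrite invr_ge0 ltW.
  apply: norm_le_rescale => //; rewrite -(star_homZ hf).
  set b := M^-1 *: a.
  have sb : star b = b by rewrite star_scale_ge0 // sa.
  have b1 : `|b| < 1 by exact: norm_lt_rescale.
  have [|c [cc sc comm _ _]] :=
    @quasi_sqrt_selfadj _ _ _ (norm_cmul_self_lt1 b1).
    by rewrite starM sb.
  apply: (@norm_le1_quasi_sqrt _ _ _ (f c)).
  - by rewrite -(star_hom_star hf) sb.
  - by rewrite -(star_hom_star hf) sc.
  - by rewrite -!(star_homM hf) comm // cmulA.
  - by rewrite -!(star_homM hf) -!(star_homD hf) cc.
move=> a; rewrite -(@ler_pXn2r _ 2) ?nnegrE ?normr_ge0 //.
rewrite -!norm_star_cmul -(star_hom_star hf) -(star_homM hf).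
by apply: sf; rewrite starM starK.
Qed.

Lemma star_hom_continuous (R : realType) (A B : cstarAlgType R) (f : A -> B) :
  star_hom f -> continuous f.
Proof.
move=> hf; apply: (@bounded_additive_continuous _ _ _ _ 1) => // [x y|x].
  exact: star_homB.
by rewrite mul1r star_hom_contractive.
Qed.

(** * Norms of sums of orthogonal elements *)

Section OrthogonalSums.
Variables (R : realType) (B : cstarAlgType R) (I : finType).
Local Notation C := R[i].

Lemma cmul_orth_sum (x y : I -> B) :
  (forall i j, i != j -> x i ** y j = 0) ->
  (\sum_i x i) ** (\sum_i y i) = \sum_i x i ** y i.
Proof.
move=> xy; rewrite cmul_suml; apply: eq_bigr => i _.
rewrite cmul_sumr (bigD1 i) //= big1 ?addr0 // => j ji.
by rewrite xy // eq_sym.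
Qed.

(** The solutions [c i] attached to the rescaled squares inherit orthogonality, so their sum is a
    solution for the sum and [norm_le1_quasi_sqrt] applies to it. *)
Lemma norm_orth_sum (z : I -> B) (M : C) :
  (forall i, star (z i) = z i) -> (forall i j, i != j -> z i ** z j = 0) ->
  0 <= M -> (forall i, `|z i| <= M) -> `|\sum_i z i| <= M.
Proof.
move=> sz oz M0 zM; apply: ler_forall_gt => N MN.
have N0 : 0 < N by exact: le_lt_trans MN.
have Ni : 0 <= N^-1 by rewrite invr_ge0 ltW.
apply: norm_le_rescale => //; rewrite scaler_sumr.
pose w i := N^-1 *: z i.
have sw i : star (w i) = w i by rewrite star_scale_ge0 // sz.
have ow i j : i != j -> w i ** w j = 0.
  by move=> ij; rewrite cmulZl cmulZr oz // !scaler0.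
have w1 i : `|w i| < 1 by rewrite norm_lt_rescale // (le_lt_trans (zM i)).
have /fin_all_exists[c cP] i : exists c, [/\ c + c = w i ** w i + c ** c,
    star c = c, w i ** c = c ** w i & forall k, w i ** k = 0 -> c ** k = 0].
  have [|c [cc sc comm ann _]] :=
    @quasi_sqrt_selfadj _ _ _ (norm_cmul_self_lt1 (w1 i)).
    by rewrite starM sw.
  exists c; split=> //; first by rewrite comm // cmulA.
  by move=> k wk; apply: ann; rewrite -cmulA wk cmul0r.
have cw i j : i != j -> c i ** w j = 0.
  by move=> ij; have [_ _ _] := cP i; apply; exact: ow.
have wc i j : i != j -> w i ** c j = 0.
  move=> ij; rewrite -[LHS]starK starM sw.
  by have [_ -> _ _] := cP j; rewrite cw ?star0 // eq_sym.
have oc i j : i != j -> c i ** c j = 0.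
  by move=> ij; have [_ _ _] := cP i; apply; exact: wc.
apply: (@norm_le1_quasi_sqrt _ _ _ (\sum_i c i)).
- by rewrite star_sum; apply: eq_bigr => i _; exact: sw.
- by rewrite star_sum; apply: eq_bigr => i _; have [] := cP i.
- by rewrite !cmul_orth_sum //; apply: eq_bigr => i _; have [] := cP i.
- rewrite !cmul_orth_sum // -!big_split /=.
  by apply: eq_bigr => i _; have [] := cP i.
Qed.

(** For [y] the sum, star y ** y is a sum of orthogonal selfadjoint terms of norm at most M^2, so
    [norm_orth_sum] bounds |y|^2. *)
Lemma norm_isometric_sum (S b : I -> B) (M : C) :
  (forall i j, i != j -> star (S i) ** S j = 0) -> (forall i, `|S i| <= 1) ->
  0 <= M -> (forall i, `|b i| <= M) ->
  `|\sum_i S i ** b i ** star (S i)| <= M.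
Proof.
move=> oS S1 M0 bM; set y := \sum_i _.
rewrite -(@ler_pXn2r _ 2) ?nnegrE ?normr_ge0 // -norm_star_cmul.
pose z i := star (S i ** b i ** star (S i)) ** (S i ** b i ** star (S i)).
have -> : star y ** y = \sum_i z i.
  rewrite /y star_sum; apply: cmul_orth_sum => i j ij.
  rewrite !starM starK -!cmulA [star (S i) ** _]cmulA oS //.
  by rewrite !(cmul0l, cmul0r).
have y1 i : `|S i ** b i ** star (S i)| <= M.
  rewrite (le_trans (norm_cmul _ _)) // norm_star.
  rewrite -[leRHS]mulr1 ler_pM // (le_trans (norm_cmul _ _)) //.
  by rewrite -[leRHS]mul1r ler_pM.
apply: norm_orth_sum => [i|i j ij||i].
- by rewrite starM starK.
- by rewrite /z !starM !starK -!cmulA [star (S i) ** (S j ** _)]cmulA oS //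
     !(cmul0l, cmul0r).
- by rewrite exprn_ge0.
- by rewrite norm_star_cmul lerXn2r ?nnegrE ?normr_ge0.
Qed.

End OrthogonalSums.

(** * Projections and their corners *)

Section Projections.
Variables (R : realType) (B : cstarAlgType R).
Local Notation C := R[i].
Implicit Types (a b p q k x y : B).

Lemma projection_norm p : projection p -> `|p| <= 1.
Proof.
case=> sp pp; have := norm_sqr_selfadj sp; rewrite pp.
have [->|p0] := eqVneq `|p| 0; first by rewrite ler01.
by rewrite expr2 -{1}[`|p|]mulr1 => /(mulfI p0) <-.
Qed.

(** For x = (1 - p) b one has star x ** x = star b ** x, whence |x|^2 <= |b| |x|. *)
Lemma projection_compl_norm p b : projection p -> `|b - p ** b| <= `|b|.
Proof.
case=> sp pp; set x := b - p ** b.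
have E : star x ** x = star b ** x.
  rewrite {1}/x starB starM sp cmulBl [X in _ - X](_ : _ = 0) ?subr0 //.
  by rewrite -cmulA cmulBr cmulA pp subrr cmul0r.
have [->|x0] := eqVneq `|x| 0; first by rewrite normr_ge0.
have xp : 0 < `|x| by rewrite lt_def x0 /=.
rewrite -(ler_pM2r xp) -expr2 -norm_star_cmul E.
by apply: le_trans (norm_cmul _ _) _; rewrite norm_star.
Qed.

(* The unit q of the corner q B q is an extreme point of its unit ball. *)
Lemma corner_extreme q k : projection q -> star k = k -> q ** k = k ->
  `|q + k| <= 1 -> `|q - k| <= 1 -> k = 0.
Proof.
move=> pq sk qk h1 h2; have [sq qq] := pq; have q1 := projection_norm pq.
have kq : k ** q = k by have := congr1 (@star R B) qk; rewrite starM sk sq.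
set p := k ** k.
(* q + k^2 is the mean of the squares of q + k and q - k. *)
have pq1 : `|q + p| <= 1.
  rewrite -(@ler_pMn2r _ 2) // -normrMn.
  have -> : (q + p) *+ 2 = (q + k) ** (q + k) + (q - k) ** (q - k).
    rewrite !cmulDl !cmulDr !cmulNl !cmulNr opprK qq qk kq addrACA.
    rewrite [q + k + _]addrACA [k + p + _]addrACA subrr addr0 add0r.
    by rewrite -!mulr2n mulrnDl.
  rewrite (le_trans (ler_normD _ _)) // mulr2n.
  by rewrite lerD // (le_trans (norm_cmul _ _)) // mulr_ile1.
apply/eqP; rewrite -normr_eq0; apply/negPn/negP => k0.
set r := `|k| ^+ 2.
have r0 : 0 < r by rewrite exprn_gt0 // lt_def k0 /=.
(* Chosen so that t (1 + r) > 1, against the inequality t r <= 1 - t derived below, and so that t (q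
   + p) has norm less than 1. *)
pose t : C := (1 + r / 2)^-1.
have t1' : 1 < 1 + r / 2 by rewrite ltrDl divr_gt0.
have t0' : 0 < 1 + r / 2 by rewrite (lt_trans ltr01).
have t0 : 0 < t by rewrite invr_gt0.
have t1 : t < 1 by rewrite invf_lt1.
have hn : `|t *: (q + p)| < 1.
  by rewrite normrZ gtr0_norm // (le_lt_trans _ t1) // ler_piMr // ltW.
have sp : star p = p by rewrite starM sk.
have sh : star (t *: (q + p)) = t *: (q + p).
  by rewrite star_scale_ge0 ?ltW // starD sq sp.
have [c [cc sc comm _ qc]] := quasi_sqrt_selfadj hn sh.
have {}qc : q ** c = c.
  by apply: qc; rewrite cmulZr cmulDr qq /p cmulA qk.
have cq : c ** q = c by have := congr1 (@star R B) qc; rewrite starM sc sq.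
have ck : c ** k = k ** c.
  by apply: comm; rewrite cmulZl cmulZr cmulDl cmulDr qk kq cmulA.
pose s := sqrtC t.
have s0 : 0 <= s by rewrite sqrtC_ge0 ltW.
have := @le_norm_sq_sum _ _ (s *: k) (q - c).
rewrite star_scale_ge0 // sk starB sq sc => /(_ erefl erefl).
rewrite cmulZl cmulZr cmulBr cmulBl kq qk ck => /(_ erefl).
(* The equation of [c] says (q - c)^2 = q - t (q + p); adding t k^2 = t p cancels [p]. *)
have -> : (s *: k) ** (s *: k) + (q - c) ** (q - c) = (1 - t) *: q.
  rewrite cmulZl cmulZr scalerA -expr2 sqrtCK -/p cmulBl !cmulBr qq qc cq.
  rewrite opprB addrACA -opprD cc opprD addrACA subrr addr0.
  by rewrite scalerDr opprD addrCA [- _ - _]addrC addNKr scalerBl scale1r.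
rewrite !normrZ exprMn (ger0_norm s0) sqrtCK -/r => trle.
have : t * r <= 1 - t.
  apply: le_trans trle _.
  by rewrite ger0_norm ?subr_ge0 ?(ltW t1) // ler_piMr // subr_ge0 ltW.
rewrite lerBrDl -{1}[t]mulr1 -mulrDr mulrC ler_pdivrMr // mul1r lerD2l.
apply/negP; rewrite lt_geF //.
by rewrite ltr_pdivrMr // mulr_natr mulr2n ltrDl.
Qed.

(** Let N be the number of indices. As h_j is minus the sum of the other h_i, q + h_j / N is the
    mean of q and the q - h_i with i != j, while q - h_j / N is the mean of q - h_j and N - 1 copies
    of q. Both have norm at most 1, so [corner_extreme] kills h_j / N. *)
Lemma corner_sum_eq0 (I : finType) (J : pred I) (q : B) (h : I -> B) :
  projection q -> (forall j, star (h j) = h j) ->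
  (forall j, q ** h j = h j) -> (forall j, `|q - h j| <= 1) ->
  \sum_(j | J j) h j = 0 -> forall j, J j -> h j = 0.
Proof.
move=> pq sh qh h1 h0 j Jj; have q1 := projection_norm pq.
pose N : C := \sum_(i | J i) 1.
have NE : N = 1 + \sum_(i | J i && (i != j)) 1 by rewrite /N (bigD1 j).
have N0 : 0 < N by rewrite NE ltr_pwDl // sumr_ge0.
have Ni : 0 <= N^-1 by rewrite invr_ge0 ltW.
have qE : q = N^-1 *: \sum_(i | J i) q.
  have -> : \sum_(i | J i) q = N *: q.
    by rewrite scaler_suml; apply: eq_bigr => i _; rewrite scale1r.
  by rewrite scalerA mulVf ?scale1r // gt_eqF.
have bound (x : B) (g : I -> B) : `|x| <= 1 -> (forall i, `|g i| <= 1) ->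
    `|N^-1 *: (x + \sum_(i | J i && (i != j)) g i)| <= 1.
  move=> x1 g1; rewrite normrZ ger0_norm // ler_pdivrMl // mulr1 NE.
  rewrite (le_trans (ler_normD _ _)) // lerD //.
  by rewrite (le_trans (ler_norm_sum _ _ _)) // ler_sum.
have : N^-1 *: h j = 0.
  apply: (corner_extreme pq).
  - by rewrite star_scale_ge0 // sh.
  - by rewrite cmulZr qh.
  - rewrite {1}qE -scalerDr.
    have -> : \sum_(i | J i) q + h j =
        q + \sum_(i | J i && (i != j)) (q - h i).
      rewrite (bigD1 j) //= sumrB -addrA; congr (_ + (_ + _)).
      by move: h0; rewrite (bigD1 j) //= => /eqP; rewrite addr_eq0 => /eqP.
    exact: bound.
  - rewrite {1}qE -scalerBr (bigD1 j) //= addrAC; exact: bound.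
by move/eqP; rewrite scaler_eq0 invr_eq0 gt_eqF //= => /eqP.
Qed.

End Projections.

(** * Cuntz-Krieger families *)

(* If p = sum_i q_i, then in the corner of q_e the elements q_e - q_e p q_e and
   q_e q_i q_e with i != e sum to 0, and each of them is at distance at most 1
   from q_e. *)
Lemma projection_sum_orth (R : realType) (B : cstarAlgType R) (I : finType)
    (J : pred I) (q : I -> B) (p : B) :
  (forall i, projection (q i)) -> projection p -> p = \sum_(i | J i) q i ->
  forall e, J e -> p ** q e = q e /\
    forall i, J i -> i != e -> q i ** q e = 0.
Proof.
move=> pq pp pE e Je; have [sq qq] := pq e; have [sp pp2] := pp.
pose h i := if i == e then q e - q e ** p ** q e else q e ** q i ** q e.
have h0 i : J i -> h i = 0.
  apply: (@corner_sum_eq0 _ _ _ _ (q e) h) => // {i} [j|j|j|].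
  - rewrite /h; case: ifP => _; first by rewrite starB !starM sq sp !cmulA.
    by have [sj _] := pq j; rewrite !starM sq sj !cmulA.
  - rewrite /h; case: ifP => _; last by rewrite !cmulA qq.
    by rewrite cmulBr !cmulA qq.
  - have q1 := projection_norm (pq e); have p1 := projection_norm pp.
    rewrite /h; case: ifP => _.
      rewrite subKr (le_trans (norm_cmul _ _)) // mulr_ile1 //.
      by rewrite (le_trans (norm_cmul _ _)) // mulr_ile1.
    rewrite -{1}qq -cmulA -cmulBr (le_trans (norm_cmul _ _)) // mulr_ile1 //.
    by rewrite (le_trans (projection_compl_norm _ _)).
  - rewrite (bigD1 e) //= {1}/h eqxx pE (bigD1 e) //= cmulDr cmulDl !qq.
    rewrite opprD addrA subrr add0r addrC; apply/eqP; rewrite subr_eq0.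
    apply/eqP; rewrite cmul_sumr cmul_suml.
    by apply: eq_bigr => j /andP[_ /negbTE je]; rewrite /h je.
(* Both claims follow from the C*-identity: star x ** x equals [h e] for x = q_e - p q_e, and [h i]
   for x = q_i q_e. *)
split=> [|i Ji ie].
  apply/esym/eqP; rewrite -subr_eq0; apply/eqP; apply: cmul_star_eq0.
  have := h0 e Je; rewrite /h eqxx => he.
  rewrite starB starM sq sp cmulBl !cmulBr qq !cmulA he sub0r.
  by rewrite -[_ ** p ** p]cmulA pp2 subrr oppr0.
apply: cmul_star_eq0; have := h0 i Ji; rewrite /h (negbTE ie) => <-.
have [si qi] := pq i; rewrite starM sq si -cmulA [q i ** (q i ** _)]cmulA.
by rewrite qi cmulA.
Qed.

Section CuntzKriegerRelations.
Variables (R : realType) (G : graph) (B : cstarAlgType R).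
Variables (P : vertex G -> B) (S : edge G -> B).
Hypothesis ck : cuntz_krieger P S.

Lemma ck_final_projection e : projection (S e ** star (S e)).
Proof.
split; first by rewrite starM starK.
by rewrite cmulA (ck_partial_isometry ck e).
Qed.

Lemma ck_rng e : S e ** P (rng e) = S e.
Proof. by rewrite -(ck_initial ck) cmulA (ck_partial_isometry ck e). Qed.

Lemma ck_isometry_norm e : `|S e| <= 1.
Proof.
rewrite -(@expr_le1 _ 2) // -norm_star_cmul (ck_initial ck).
exact/projection_norm/(ck_projection ck).
Qed.

(** The final projections at one source sum to the projection [P (src e)], so [projection_sum_orth]
    makes them subprojections of it and mutually orthogonal. *)
Lemma ck_src_orth e : P (src e) ** S e = S e /\
  forall f, src f = src e -> f != e -> star (S f) ** S e = 0.
Proof.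
have [|pS oS] := @projection_sum_orth _ _ _ [pred f | src f == src e]
  (fun f => S f ** star (S f)) _ ck_final_projection
  (ck_projection ck (src e)) _ e (eqxx _).
  by rewrite (ck_final ck) //; exists e.
split=> [|f fe nfe].
  by rewrite -{1}(ck_partial_isometry ck e) cmulA pS (ck_partial_isometry ck e).
have /(congr1 (fun x => star (S f) ** x ** S e)) := oS f (introT eqP fe) nfe.
rewrite cmul0r cmul0l => <-.
rewrite -!cmulA [_ ** (star (S e) ** S e)]cmulA (ck_partial_isometry ck e).
have := congr1 (@star R B) (ck_partial_isometry ck f).
by rewrite !starM starK !cmulA => ->.
Qed.

Lemma ck_src e : P (src e) ** S e = S e.
Proof. by have [] := ck_src_orth e. Qed.

(** For distinct sources, S_e and S_f lie under orthogonal vertex projections; a common source is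
    the case of [ck_src_orth]. *)
Lemma ck_star_orth e f : e != f -> star (S e) ** S f = 0.
Proof.
move=> ef; have [sf|sf] := eqVneq (src e) (src f).
  by have [_] := ck_src_orth f; apply.
have [sp _] := ck_projection ck (src e).
by rewrite -ck_src starM sp -cmulA -[S f]ck_src [P _ ** (_ ** _)]cmulA
  (ck_orthogonal ck) // cmul0l cmul0r.
Qed.

Lemma ck_sum_final : no_sinks G ->
  \sum_e S e ** star (S e) = \sum_v P v.
Proof.
move=> ns; rewrite (partition_big (@src G) xpredT) //=.
by apply: eq_bigr => v _; rewrite (ck_final ck).
Qed.

End CuntzKriegerRelations.

(** * Correspondences with a finite frame *)

Section Correspondences.
Variables (R : realType) (A : cstarAlgType R) (X : correspondence A).
Implicit Types (x y z : X) (a b : A) (T : X -> X).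

Lemma inner_addr x y z : inner x (y + z) = inner x y + inner x z.
Proof. by rewrite -{1}[y]scale1r inner_linear scale1r. Qed.
Lemma inner0r x : inner x 0 = 0.
Proof. by apply: (addIr (inner x 0)); rewrite -inner_addr !add0r. Qed.
Lemma inner_scaler k x y : inner x (k *: y) = k *: inner x y.
Proof. by rewrite -[k *: y]addr0 inner_linear inner0r addr0. Qed.
Lemma inner_sumr (I : Type) (r : seq I) (P : pred I) (F : I -> X) x :
  inner x (\sum_(i <- r | P i) F i) = \sum_(i <- r | P i) inner x (F i).
Proof.
by apply: (big_morph (inner x)) => [y z|]; rewrite ?inner_addr ?inner0r.
Qed.
Lemma inner_ractl x y a : inner (ract x a) y = star a ** inner x y.
Proof. by rewrite -star_inner inner_ract starM star_inner. Qed.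
Lemma inner_suml (I : Type) (r : seq I) (P : pred I) (F : I -> X) x :
  inner (\sum_(i <- r | P i) F i) x = \sum_(i <- r | P i) inner (F i) x.
Proof.
rewrite -star_inner inner_sumr star_sum.
by apply: eq_bigr => i _; rewrite star_inner.
Qed.

Lemma innerNr x y : inner x (- y) = - inner x y.
Proof. by rewrite -scaleN1r inner_scaler scaleN1r. Qed.

Lemma inner_inj x y : (forall z, inner z x = inner z y) -> x = y.
Proof.
move=> xy; apply/eqP; rewrite -subr_eq0; apply/eqP/inner_definite.
by rewrite inner_addr innerNr xy subrr.
Qed.

Lemma ract0l a : ract (0 : X) a = 0.
Proof.
apply: (addIr (ract 0 a)); rewrite add0r -{1}[ract 0 a]scale1r.
by rewrite -ract_linearl scale1r addr0.
Qed.

(** [adjointable] speaks of bare functions; linearity is recovered by pairing with every vector and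
    using definiteness. *)
Lemma adjointable_linear T : adjointable T ->
  forall k x y, T (k *: x + y) = k *: T x + T y.
Proof.
case=> S TS k x y; apply: inner_inj => z.
rewrite -star_inner TS star_inner inner_linear.
by rewrite inner_linear -![inner z (T _)]star_inner !TS !star_inner.
Qed.

Lemma adjointable_ract T : adjointable T ->
  forall x a, T (ract x a) = ract (T x) a.
Proof.
case=> S TS x a; apply: inner_inj => z.
rewrite inner_ract -star_inner TS star_inner inner_ract.
by rewrite -[inner z (T x)]star_inner TS star_inner.
Qed.

Lemma lact_adjointable a : adjointable (lact a : X -> X).
Proof. by exists (lact (star a)) => x y; exact: lact_adjoint. Qed.

Lemma adjointable_sum T : adjointable T ->
  forall (I : Type) (r : seq I) (F : I -> X),
  T (\sum_(i <- r) F i) = \sum_(i <- r) T (F i).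
Proof.
move=> aT; have lT := adjointable_linear aT.
have TD x y : T (x + y) = T x + T y by rewrite -{1}[x]scale1r lT scale1r.
have T0 : T 0 = 0 by apply: (addIr (T 0)); rewrite -TD !add0r.
by move=> I r F; apply: (big_morph T) => [x y|]; rewrite ?TD ?T0.
Qed.

Definition theta_sum (s : seq (X * X)) : X -> X :=
  fun z => \sum_(p <- s) theta p.1 p.2 z.

Lemma theta_sum_compact s : compact_operator (theta_sum s).
Proof.
split; last first.
  move=> e e0; exists (theta_sum s); first by exists s.
  move=> z; rewrite subrr /corr_norm inner0r normr0 sqrtC0.
  by rewrite mulr_ge0 ?sqrtC_ge0 // ltW.
exists (theta_sum [seq (p.2, p.1) | p <- s]) => x y.
rewrite /theta_sum big_map inner_suml inner_sumr; apply: eq_bigr => p _.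
by rewrite /theta inner_ractl inner_ract star_inner.
Qed.

Section Toeplitz.
Variables (B : cstarAlgType R) (psi : X -> B) (pi : A -> B).
Hypothesis ht : toeplitz psi pi.

Lemma toeplitz_star_hom : star_hom pi. Proof. by case: ht. Qed.
Lemma toeplitz_ract x a : psi (ract x a) = psi x ** pi a.
Proof. by case: ht. Qed.
Lemma toeplitz_lact a x : psi (lact a x) = pi a ** psi x.
Proof. by case: ht. Qed.
Lemma toeplitz_inner x y : star (psi x) ** psi y = pi (inner x y).
Proof. by case: ht. Qed.
Lemma toeplitz_linear k x y : psi (k *: x + y) = k *: psi x + psi y.
Proof. by case: ht. Qed.
Lemma toeplitzD x y : psi (x + y) = psi x + psi y.
Proof. by rewrite -{1}[x]scale1r toeplitz_linear scale1r. Qed.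
Lemma toeplitz0 : psi 0 = 0.
Proof. by apply: (addIr (psi 0)); rewrite -toeplitzD !add0r. Qed.
Lemma toeplitz_sum (I : Type) (r : seq I) (P : pred I) (F : I -> X) :
  psi (\sum_(i <- r | P i) F i) = \sum_(i <- r | P i) psi (F i).
Proof. by apply: (big_morph psi) => [x y|]; rewrite ?toeplitzD ?toeplitz0. Qed.

Lemma induced_theta_sum (pi1 : (X -> X) -> B) s :
  induced_on_compacts psi pi1 ->
  pi1 (theta_sum s) = \sum_(p <- s) psi p.1 ** star (psi p.2).
Proof.
case=> lin _ _ th; elim: s => [|p s IH].
  (* Writing the zero operator as a [theta] brings it under the last clause of
     [induced_on_compacts]. *)
  have -> : theta_sum [::] = theta 0 0.
    by apply/funext => z; rewrite /theta_sum big_nil /theta ract0l.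
  by rewrite th big_nil toeplitz0 cmul0l.
have -> : theta_sum (p :: s) = fun z => 1 *: theta p.1 p.2 z + theta_sum s z.
  by apply/funext => z; rewrite /theta_sum big_cons scale1r.
rewrite lin; last exact: theta_sum_compact.
  by rewrite scale1r th IH big_cons.
have -> : theta p.1 p.2 = theta_sum [:: p].
  by apply/funext => z; rewrite /theta_sum big_seq1.
exact: theta_sum_compact.
Qed.

End Toeplitz.

Section Frame.
Variables (I : finType) (d : I -> X).
Hypothesis frame : forall x, x = \sum_i ract (d i) (inner (d i) x).

Lemma adjointable_frame T x : adjointable T ->
  T x = \sum_i ract (T (d i)) (inner (d i) x).
Proof.
move=> aT; rewrite {1}[x]frame (adjointable_sum aT).
by apply: eq_bigr => i _; rewrite (adjointable_ract aT).
Qed.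

Lemma adjointable_theta_sum T : adjointable T ->
  T = theta_sum [seq (T (d i), d i) | i <- index_enum I].
Proof.
move=> aT; apply/funext => x.
by rewrite /theta_sum big_map (adjointable_frame _ aT).
Qed.

Variables (B : cstarAlgType R) (psi : X -> B) (pi : A -> B).
Hypothesis ht : toeplitz psi pi.

Lemma toeplitz_frame x : psi x = \sum_i psi (d i) ** pi (inner (d i) x).
Proof.
rewrite {1}[x]frame (toeplitz_sum ht).
by apply: eq_bigr => i _; rewrite (toeplitz_ract ht).
Qed.

(** The formula is forced by the expansion of T as the sum of the [theta (T (d i)) (d i)]. *)
Lemma induced_frame :
  induced_on_compacts psi (fun T => \sum_i psi (T (d i)) ** star (psi (d i))).
Proof.
have starpi := star_hom_star (toeplitz_star_hom ht).
split.
- move=> k S T _ _; rewrite scaler_sumr -big_split; apply: eq_bigr => i _ /=.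
  by rewrite (toeplitz_linear ht) cmulDl cmulZl.
- move=> S T [aS _] [aT _]; rewrite cmul_sumr; apply: eq_bigr => i _ /=.
  rewrite cmulA cmul_suml (adjointable_frame _ aS) (toeplitz_sum ht).
  congr (_ ** _); apply: eq_bigr => j _.
  by rewrite (toeplitz_ract ht) -cmulA (toeplitz_inner ht).
- move=> S T _ ST; rewrite star_sum.
  (* Expanding along the frame gives a double sum whose coefficients the adjoint relation rewrites
     from T to S; summing in the other order gives the adjoint side. *)
  transitivity (\sum_i \sum_j
      psi (d j) ** star (psi (d i) ** pi (inner (d i) (S (d j))))).
    apply: eq_bigr => i _; rewrite toeplitz_frame cmul_suml.
    apply: eq_bigr => j _; rewrite starM -starpi star_inner ST.
    by rewrite -cmulA.
  rewrite exchange_big; apply: eq_bigr => j _ /=.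
  by rewrite starM starK -cmul_sumr -star_sum -toeplitz_frame.
- move=> x y; rewrite [psi y]toeplitz_frame star_sum cmul_sumr.
  apply: eq_bigr => i _; rewrite starM -starpi star_inner.
  by rewrite (toeplitz_ract ht) cmulA.
Qed.

(** Every [lact a] is a finite sum of operators [theta], hence compact, so covariance constrains
    every a, and the frame determines the value of [pi1] at [lact a]. *)
Lemma cp_covariant_frame : cp_covariant psi pi <->
  forall a, pi a = \sum_i psi (lact a (d i)) ** star (psi (d i)).
Proof.
split=> [[pi1 hpi1 cov] a|cov]; last first.
  exists (fun T => \sum_i psi (T (d i)) ** star (psi (d i))).
    exact: induced_frame.
  by move=> a _; rewrite -cov.
have E := adjointable_theta_sum (lact_adjointable a).
rewrite -cov; last by rewrite E; exact: theta_sum_compact.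
by rewrite {1}E (induced_theta_sum ht _ hpi1) big_map.
Qed.

End Frame.
End Correspondences.

(** * The Mauldin-Williams correspondence *)

Section TagIndicator.
Variables (R : realType) (I : finType) (Y : I -> compactSpaceType).
Local Notation K := ({i : I & Y i} : compactSpaceType).

Lemma tag_indicator_continuous (i : I) :
  continuous (fun p : K => (tag p == i)%:R : (R[i])^o).
Proof. by apply: continuous_sigT => j x; exact: cvg_cst. Qed.

Definition tag_indicator i : cfun R K := mkcfun (@tag_indicator_continuous i).

Lemma tag_indicator_mul i j :
  tag_indicator i ** tag_indicator j = if i == j then tag_indicator i else 0.
Proof.
apply/cfunP => p; rewrite -[LHS]/((tag p == i)%:R * (tag p == j)%:R).
case: (eqVneq i j) => [<-|ij]; first by rewrite -natrM mulnb andbb.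
rewrite -natrM mulnb [RHS]/(0 : R[i]).
by case: eqVneq => [->|//]; rewrite (negbTE ij).
Qed.

Lemma star_tag_indicator i : star (tag_indicator i) = tag_indicator i.
Proof. by apply/cfunP => p; exact: conjC_nat. Qed.

End TagIndicator.

Lemma cfun_sum (R : realType) (K : compactSpaceType) (I : Type) (r : seq I)
    (P : pred I) (F : I -> cfun R K) x :
  (\sum_(i <- r | P i) F i) x = \sum_(i <- r | P i) F i x.
Proof. exact: (big_morph (fun f : cfun R K => f x)). Qed.

Lemma cfun_mulC (R : realType) (K : compactSpaceType) (a b : cfun R K) :
  a ** b = b ** a.
Proof. by apply/cfunP => x; exact: mulrC. Qed.

Section MWFrame.
Variables (R : realType) (G : graph) (M : mauldin_williams R G).
Local Notation A := (cfun R (mw_total M)).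
Local Notation X := (mw_correspondence M).
Implicit Types (a b : A) (x y : X).

Definition vertex_ind v : A := tag_indicator R (mw_space M) v.
Definition edge_ind e : X :=
  tag_indicator R (fun e : edge G => mw_space M (rng e)) e.

Lemma inner_edge_ind e x p : (inner (edge_ind e) x : A) p =
  untag 0 (fun t : mw_space M (rng e) => (x : cfun R _) (mw_point t)) p.
Proof.
rewrite -[LHS]/(mw_inner_fun _ _ p) /mw_inner_fun (bigD1 e) //=.
rewrite [X in _ + X]big1 ?addr0 => [|f fe].
  have [[t _ E]|E] := untag_cases (0 : R[i]) (rng e) p; rewrite !E //.
  rewrite -[X in X^*]/((e == e)%:R : R[i]).
  by rewrite eqxx conjC1 mul1r.
have [[t _ E]|E] := untag_cases (0 : R[i]) (rng f) p; rewrite !E //.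
rewrite -[X in X^*]/((f == e)%:R : R[i]).
by rewrite (negbTE fe) conjC0 mul0r.
Qed.

Lemma inner_edge_ind_point e x (t : mw_space M (rng e)) :
  (inner (edge_ind e) x : A) (mw_rng_point (mw_point t)) =
  (x : cfun R _) (mw_point t).
Proof.
rewrite inner_edge_ind.
exact: (@untagE _ (fun v => mw_space M v : Type) R[i] 0 (rng e) _
         (mw_rng_point (mw_point t)) erefl).
Qed.

Lemma mw_frame x : x = \sum_e ract (edge_ind e) (inner (edge_ind e) x).
Proof.
apply/(@cfunP R (mw_edge_total M)) => -[e t].
symmetry.
apply: (eq_trans (@cfun_sum R (mw_edge_total M) _ _ _ _ _)).
rewrite (bigD1 e) //= big1 ?addr0 => [|f fe].
  rewrite -[LHS]/((e == e)%:R * (inner (edge_ind e) x : A)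
    (mw_rng_point (mw_point t))).
  by rewrite eqxx mul1r inner_edge_ind_point.
rewrite -[LHS]/((e == f)%:R * (inner (edge_ind f) x : A)
    (mw_rng_point (mw_point t))).
by rewrite eq_sym (negbTE fe) mul0r.
Qed.

Lemma inner_edge_ind_vertex e x :
  vertex_ind (rng e) ** inner (edge_ind e) x = inner (edge_ind e) x.
Proof.
apply/cfunP => p.
rewrite -[LHS]/((tag p == rng e)%:R * (inner (edge_ind e) x : A) p).
rewrite inner_edge_ind.
have [[t -> E]|E] := untag_cases (0 : R[i]) (rng e) p; rewrite !E ?mulr0 //.
by rewrite eqxx mul1r.
Qed.

Lemma inner_edge_edge e f :
  inner (edge_ind e) (edge_ind f) = if e == f then vertex_ind (rng e) else 0.
Proof.
apply/cfunP => p; rewrite inner_edge_ind.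
have [[t -> E]|E] := untag_cases (0 : R[i]) (rng e) p; rewrite E.
  rewrite -[LHS]/((e == f)%:R : R[i]); case: eqP => // _.
  by rewrite -[RHS]/((rng e == rng e)%:R : R[i]) eqxx.
case: eqP => // _; rewrite -[RHS]/((tag p == rng e)%:R).
have [pe|//] := eqVneq (tag p) (rng e).
(* Here [untag] is assumed to take its default 0 although [p] lies over [rng e]; the constant
   function 1 refutes this. *)
move: p pe E => [v t] /= ve; subst v => /(_ (fun=> 1)).
rewrite (@untagE _ (fun v => mw_space M v : Type) R[i] 0 (rng e) _
  (existT _ (rng e) t) erefl) => /eqP.
by rewrite oner_eq0.
Qed.

Lemma ract_edge_ind e : ract (edge_ind e) (vertex_ind (rng e)) = edge_ind e.
Proof.
apply/(@cfunP R (mw_edge_total M)) => -[f t].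
rewrite -[LHS]/((f == e)%:R * (rng f == rng e)%:R).
rewrite -[RHS]/((f == e)%:R); case: eqVneq => [->|_]; last by rewrite mul0r.
by rewrite eqxx mulr1.
Qed.

(* The function a o phi_e on T_(r e), extended by 0. *)
Definition pull e a : A := inner (edge_ind e) (lact a (edge_ind e)).

Lemma pullE e a p : pull e a p =
  untag 0 (fun t : mw_space M (rng e) => a (mw_src_point (mw_point t))) p.
Proof.
rewrite /pull inner_edge_ind.
have [[t _ E]|E] := untag_cases (0 : R[i]) (rng e) p; rewrite !E //.
rewrite -[LHS]/(a (mw_src_point (mw_point t)) * (e == e)%:R).
by rewrite eqxx mulr1.
Qed.

Lemma pull_point e a (t : mw_space M (rng e)) :
  pull e a (mw_rng_point (mw_point t)) = a (mw_src_point (mw_point t)).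
Proof.
rewrite pullE; exact: (@untagE _ (fun v => mw_space M v : Type) R[i] 0 (rng e)
  _ (mw_rng_point (mw_point t)) erefl).
Qed.

Lemma pull_linear e k a b : pull e (k *: a + b) = k *: pull e a + pull e b.
Proof. by rewrite /pull lact_linear inner_linear. Qed.

Lemma pullM e a b : pull e (a ** b) = pull e a ** pull e b.
Proof.
apply/cfunP => p; rewrite -[RHS]/(pull e a p * pull e b p) !pullE.
have [[t _ E]|E] := untag_cases (0 : R[i]) (rng e) p; rewrite !E //.
by rewrite mul0r.
Qed.

Lemma pull_star e a : pull e (star a) = star (pull e a).
Proof. by rewrite /pull star_inner lact_adjoint. Qed.

(** Over the single edge e the left action multiplies by a o phi_e, a function of the point of T_(r
    e), so it is also a right action. *)
Lemma lact_edge_ind e a : lact a (edge_ind e) = ract (edge_ind e) (pull e a).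
Proof.
apply/(@cfunP R (mw_edge_total M)) => -[f t].
rewrite -[LHS]/(a (mw_src_point (mw_point t)) * (f == e)%:R).
rewrite -[RHS]/((f == e)%:R * pull e a (mw_rng_point (mw_point t))).
case: (eqVneq f e) t => [-> t|_ t]; last by rewrite mulr0 mul0r.
by rewrite pull_point mulrC.
Qed.

Lemma inner_edge_lact e a x :
  inner (edge_ind e) (lact a x) = pull e a ** inner (edge_ind e) x.
Proof.
rewrite -[LHS]star_inner lact_adjoint star_inner lact_edge_ind inner_ractl.
by rewrite pull_star starK.
Qed.

Lemma pull_vertex e v :
  pull e (vertex_ind v) = if src e == v then vertex_ind (rng e) else 0.
Proof.
have -> : vertex_ind (rng e) = inner (edge_ind e) (edge_ind e).
  by rewrite inner_edge_edge eqxx.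
apply/cfunP => p; rewrite pullE.
have [[t -> E]|E] := untag_cases (0 : R[i]) (rng e) p; rewrite E.
  rewrite -[LHS]/((src e == v)%:R); case: eqP => // _.
  rewrite (@inner_edge_ind_point e (edge_ind e) t).
  by rewrite -[RHS]/((e == e)%:R) eqxx.
by case: eqP => // _; rewrite inner_edge_ind E.
Qed.

Lemma sum_vertex_ind a : (\sum_v vertex_ind v) ** a = a.
Proof.
apply/cfunP => p; rewrite -[LHS]/((\sum_v vertex_ind v : A) p * a p).
rewrite [X in X * _](_ : _ = 1) ?mul1r //.
apply: (eq_trans (@cfun_sum _ _ _ _ _ _ _)).
rewrite (bigD1 (tag p)) //= big1 => [|v vp].
  by rewrite addr0 -[LHS]/((tag p == tag p)%:R) eqxx.
by rewrite -[LHS]/((tag p == v)%:R) eq_sym (negbTE vp).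
Qed.

End MWFrame.

(** * Boundedness and uniform continuity on compact metric spaces *)

Section CompactMetricSpaces.
Variables (R : realType) (K : compactMetricType R).
Implicit Types x y : K.

(** Near-covering compactness makes a bound on the distance to [x0] uniform. The form with D near
    infinity lets the finitely many T_v share one D. *)
Lemma compact_metric_bounded : \forall D \near +oo, forall x y : K,
  mdist x y <= D.
Proof.
have [x0|K0] := pselect (exists x0 : K, True); last first.
  by apply: nearW => D x; case: K0; exists x.
case: x0 => x0 _.
have := compact_near_coveringP [set: K].
case=> /(_ (@compact_setT K)) /(_ R +oo
  (fun D x => mdist x0 x <= D / 2)) near_cov _.
have {}near_cov : \forall D \near +oo, forall x, mdist x0 x <= D / 2.
  have h : \forall D \near +oo, [set: K] `<=` (fun x => mdist x0 x <= D / 2).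
    apply: near_cov => x _.
    exists (ball x 1, [set D | 2 * (mdist x0 x + 1) <= D]).
      by split; [exact: nbhsx_ballx|by apply: nbhs_pinfty_ge; rewrite num_real].
    case=> y D [/= xy Dge]; rewrite ler_pdivlMr // mulrC (le_trans _ Dge) //.
    rewrite ler_pM2l // (le_trans (metric_triangle _ x _)) // lerD2l.
    by move: xy; rewrite ballEmdist => /ltW.
  by apply: filterS h => D hD x; exact: hD.
apply: filterS near_cov => D hD x y.
rewrite (le_trans (metric_triangle _ x0 _)) // [leRHS]splitr.
by rewrite lerD // metric_sym.
Qed.

(** Uniform continuity, stated for d near 0 so that finitely many spaces share one d. *)
Lemma compact_metric_uniform (f : K -> (R[i])^o) (e : R[i]) :
  continuous f -> 0 < e ->
  \forall d \near 0^'+, forall x y : K, mdist x y < d -> `|f x - f y| <= e.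
Proof.
move=> cf e0.
have := compact_near_coveringP [set: K].
case=> /(_ (@compact_setT K)) /(_ R 0^'+
  (fun d x => forall y, mdist x y < d -> `|f x - f y| <= e)) near_cov _.
have h : \forall d \near 0^'+,
    [set: K] `<=` (fun x => forall y, mdist x y < d -> `|f x - f y| <= e).
  apply: near_cov => x _.
  have e2 : 0 < e / 2 by rewrite divr_gt0.
  have /(@cvgrPdist_lt _ (R[i])^o) /(_ _ e2) := cf x.
  case/nbhs_ballP => r /= r0 hr.
  (* With y within r / 2 of x and d <= r / 2, both y and z stay within r of x. *)
  exists (ball x (r / 2), [set d | d <= r / 2]).
    split; first by apply: nbhsx_ballx; rewrite divr_gt0.
    by apply: nbhs_right_le; rewrite divr_gt0.
  case=> y d [/= xy dr] z yz; rewrite [leRHS]splitr.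
  move: xy; rewrite ballEmdist /= => xy.
  have xz : mdist x z < r.
    rewrite (le_lt_trans (metric_triangle _ y _)) // [ltRHS]splitr ltrD //.
    exact: lt_le_trans dr.
  rewrite (le_trans (ler_distD (f x) _ _)) // lerD // ltW //.
    rewrite distrC; apply: hr; rewrite ballEmdist /=.
    by rewrite (lt_trans xy) // ltr_pdivrMr // ltr_pMr // ltr1n.
  by apply: hr; rewrite ballEmdist.
by apply: filterS h => d hd x y; exact: hd.
Qed.

End CompactMetricSpaces.

Section Oscillation.
Variables (R : realType) (G : graph) (M : mauldin_williams R G).
Local Notation A := (cfun R (mw_total M)).
Implicit Types (a b : A).
Let pt v (x : mw_space M v) : mw_total M :=
  existT (fun v => mw_space M v : Type) v x.

(* [osc_le eps n a]: every a o phi_w with w a path of length n oscillates by at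
   most eps. *)
Fixpoint osc_le (eps : R[i]) (n : nat) (a : A) : Prop :=
  if n is m.+1 then forall e, osc_le eps m (pull e a)
  else forall v (x y : mw_space M v), `|a (pt x) - a (pt y)| <= eps.

Lemma osc_le_exists a (eps : R[i]) : 0 < eps -> exists n, osc_le eps n a.
Proof.
move=> eps0; have [c [/andP[c0 c1] phi_c]] := mw_contraction M.
have [D DP] : exists D : R, forall v (x y : mw_space M v), mdist x y <= D.
  have : \forall D \near +oo, forall v (x y : mw_space M v), mdist x y <= D.
    by apply: filter_forall => v; exact: compact_metric_bounded.
  by move/filter_ex.
have [d [d0 dP]] : exists d : R, 0 < d /\ forall v (x y : mw_space M v),
    mdist x y < d -> `|a (pt x) - a (pt y)| <= eps.
  have : \forall d \near 0^'+, forall v (x y : mw_space M v),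
      mdist x y < d -> `|a (pt x) - a (pt y)| <= eps.
    apply: filter_forall => v.
    apply: (compact_metric_uniform (f := fun x => a (pt x) : (R[i])^o)) => // x.
    apply: (@continuous_comp _ (mw_total M) _ (@pt v) (a : _ -> (R[i])^o)).
      exact: existT_continuous.
    exact: cfun_cts.
  move=> /(filterI (nbhs_right_gt 0)) /filter_ex[d [d0 hd]].
  by exists d.
(* The image of phi_w for a path w of length n has diameter at most D c^n; n brings this below d.
   The maximum with 1 keeps the divisor positive. *)
have D1 : 0 < Num.max D 1 by rewrite lt_max ltr01 orbT.
have [n hn] := expr_lt_eps (ltW c0) c1 (divr_gt0 d0 D1).
exists n; have {hn} : Num.max D 1 * c ^+ n < d by rewrite mulrC -ltr_pdivlMr.
(* The scale varies in the induction: if a oscillates by at most eps at scale d, then [pull e a]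
   does at scale d / c. *)
elim: n a d d0 dP => [|n IH] a d d0 dP hn /=.
  move=> v x y; apply: dP; apply: le_lt_trans (DP _ _ _) _.
  by rewrite (le_lt_trans _ hn) // expr0 mulr1 le_max lexx.
move=> e; apply: (IH _ (d / c)); first by rewrite divr_gt0.
  move=> v x y xy; rewrite !pullE.
  have [ve|ve] := eqVneq v (rng e); last first.
    by rewrite !untag_dflt //= subrr normr0 ltW.
  subst v; rewrite -!pullE (pull_point a x) (pull_point a y); apply: dP.
  by rewrite (le_lt_trans (phi_c _ _ _)) // mulrC -ltr_pdivlMr.
by rewrite ltr_pdivlMr // -mulrA -exprSr.
Qed.

End Oscillation.

(** * Existence and uniqueness of the fixed point of [push] *)

Section FixedRepresentation.
Variables (R : realType) (G : graph) (M : mauldin_williams R G).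
Local Notation A := (cfun R (mw_total M)).
Local Notation X := (mw_correspondence M).
Hypothesis ns : no_sinks G.
Variables (B : cstarAlgType R) (P : vertex G -> B) (S : edge G -> B).
Hypothesis ck : cuntz_krieger P S.
Implicit Types (a b : A) (rho sigma : A -> B).

Definition vertex_rep rho : Prop :=
  star_hom rho /\ forall v, rho (vertex_ind M v) = P v.

Definition push rho a : B := \sum_e S e ** rho (pull e a) ** star (S e).

Lemma vertex_rep_cut rho e a : vertex_rep rho ->
  P (rng e) ** rho (pull e a) = rho (pull e a).
Proof.
by case=> hr <-; rewrite -(star_homM hr) /pull inner_edge_ind_vertex.
Qed.

(** Multiplicativity holds because cross terms vanish by [ck_star_orth] and star S_e ** S_e = P_(r
    e) is a unit for [rho (pull e a)]. *)
Lemma push_star_hom rho : vertex_rep rho -> star_hom (push rho).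
Proof.
move=> vr; have [hr _] := vr; split.
- move=> k a b; rewrite /push scaler_sumr -big_split; apply: eq_bigr => e _ /=.
  rewrite pull_linear (star_homD hr) (star_homZ hr).
  by rewrite cmulDr cmulDl cmulZr cmulZl.
- move=> a b; rewrite /push cmul_orth_sum => [|e f ef].
    apply: eq_bigr => e _; rewrite pullM (star_homM hr) -!cmulA.
    rewrite [star (S e) ** (S e ** _)]cmulA (ck_initial ck).
    by rewrite [P _ ** (_ ** _)]cmulA vertex_rep_cut.
  rewrite -!cmulA [star (S e) ** (S f ** _)]cmulA (ck_star_orth ck) //.
  by rewrite cmul0l !cmul0r.
- move=> a; rewrite /push star_sum; apply: eq_bigr => e _.
  by rewrite pull_star (star_hom_star hr) !starM starK cmulA.
Qed.

(** On [vertex_ind M v] only the edges with source v contribute, so the claim is the Cuntz-Krieger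
    relation at v, available because v is not a sink. *)
Lemma push_vertex_rep rho : vertex_rep rho -> vertex_rep (push rho).
Proof.
move=> vr; have [hr rP] := vr; split; first exact: push_star_hom.
move=> v; rewrite /push (ck_final ck) // [RHS]big_mkcond.
apply: eq_bigr => e _; rewrite pull_vertex.
case: ifP => _; last by rewrite (star_hom0 hr) cmul0r cmul0l.
by rewrite rP (ck_rng ck).
Qed.

Lemma iter_push_vertex_rep n rho :
  vertex_rep rho -> vertex_rep (iter n push rho).
Proof. by elim: n => //= n IH vr; apply: push_vertex_rep; exact: IH. Qed.

Lemma push_dist rho sigma a m : 0 <= m ->
  (forall e, `|rho (pull e a) - sigma (pull e a)| <= m) ->
  `|push rho a - push sigma a| <= m.
Proof.
move=> m0 hm; rewrite /push -sumrB.
under eq_bigr do rewrite -cmulBl -cmulBr.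
apply: norm_isometric_sum => // [e f ef|e]; first exact: ck_star_orth ck _ _ ef.
exact: ck_isometry_norm ck e.
Qed.

(** [step a] is a locally constant approximation of a. All [vertex_rep] maps agree on it, as it is a
    combination of vertex indicators. *)
Let base v := sval (cid (mw_space_neq0 M v)).
Let base_pt v : mw_total M := existT (fun v => mw_space M v : Type) v (base v).
Let step a : A := \sum_v a (base_pt v) *: vertex_ind M v.

Let stepE a p : step a p = a (base_pt (tag p)).
Proof.
apply: (eq_trans (@cfun_sum _ _ _ _ _ _ _)).
rewrite (bigD1 (tag p)) //= big1 => [|v vp].
  rewrite addr0 -[LHS]/(a (base_pt (tag p)) * (tag p == tag p)%:R).
  by rewrite eqxx mulr1.
rewrite -[LHS]/(a (base_pt v) * (tag p == v)%:R).
by rewrite eq_sym (negbTE vp) mulr0.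
Qed.

(** At n = 0, a is within eps of [step a], where both maps agree, and each is contractive, hence eps
    + eps. [push_dist] then propagates the bound from the [pull e a] to a. *)
Lemma vertex_rep_dist eps n rho sigma a : 0 <= eps ->
  vertex_rep rho -> vertex_rep sigma -> osc_le eps n a ->
  `|iter n push rho a - iter n push sigma a| <= eps + eps.
Proof.
move=> e0 vr vs; have ee0 : 0 <= eps + eps by rewrite addr_ge0.
elim: n a => [|n IH] a /= osc; last first.
  by apply: push_dist => // e; apply: IH; exact: osc.
have [[hr rP] [hs sP]] := (vr, vs).
have sa : `|a - step a| <= eps.
  apply: cfun_norm_le => // -[v x].
  rewrite -[X in `|X|]/(a (existT _ v x) - step a (existT _ v x)) stepE.
  exact: osc.
have E : rho (step a) = sigma (step a).
  rewrite (star_hom_sum hr) (star_hom_sum hs); apply: eq_bigr => v _.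
  by rewrite (star_homZ hr) (star_homZ hs) rP sP.
have -> : rho a - sigma a = rho (a - step a) - sigma (a - step a).
  by rewrite (star_homB hr) (star_homB hs) E opprB addrA subrK.
rewrite (le_trans (ler_normB _ _)) //.
by rewrite lerD // (le_trans (star_hom_contractive _ _)).
Qed.

Lemma fixed_vertex_rep_unique rho sigma :
  vertex_rep rho -> vertex_rep sigma ->
  (forall a, push rho a = rho a) -> (forall a, push sigma a = sigma a) ->
  rho = sigma.
Proof.
move=> vr vs fr fs.
have iterE tau : (forall a, push tau a = tau a) ->
    forall n, iter n push tau = tau.
  by move=> ft; elim=> //= n ->; apply/funext.
apply/funext => a; apply/eqP; rewrite -subr_eq0 -normr_le0.
apply: ler_forall_gt => e e0.
have e20 : 0 < e / 2 by rewrite divr_gt0.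
have [n osc] := osc_le_exists a e20.
have := vertex_rep_dist (ltW e20) vr vs osc.
by rewrite !iterE // -splitr.
Qed.

(** Evaluation at the base points starts the iteration that leads to the fixed point. *)
Lemma step_vertex_rep : vertex_rep (fun a => \sum_v a (base_pt v) *: P v).
Proof.
have orth v w : v != w -> P v ** P w = 0 by exact: ck_orthogonal ck v w.
split; first split.
- move=> k a b; rewrite scaler_sumr -big_split; apply: eq_bigr => v _ /=.
  by rewrite scalerA -scalerDl.
- move=> a b; rewrite cmul_orth_sum => [|v w vw].
    apply: eq_bigr => v _; rewrite cmulZl cmulZr scalerA.
    by have [_ ->] := ck_projection ck v.
  by rewrite cmulZl cmulZr orth // !scaler0.
- move=> a; rewrite star_sum; apply: eq_bigr => v _.
  by rewrite starZ; have [-> _] := ck_projection ck v.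
- move=> v; rewrite (bigD1 v) //= big1 => [|w wv].
    by rewrite addr0 -[X in X *: _]/((v == v)%:R) eqxx scale1r.
  by rewrite -[X in X *: _]/((w == v)%:R) (negbTE wv) scale0r.
Qed.

(** The iterates are pointwise Cauchy: [u N] and [u n] are N-fold pushes of [rho0] and [u (n - N)],
    which [vertex_rep_dist] compares. The algebraic relations pass to the limit. *)
Lemma fixed_vertex_rep_exists :
  exists2 rho, vertex_rep rho & forall a, push rho a = rho a.
Proof.
pose rho0 a := \sum_v a (base_pt v) *: P v.
pose u n := iter n push rho0.
have vu n : vertex_rep (u n).
  by apply: iter_push_vertex_rep; exact: step_vertex_rep.
have ucvg a : exists l : B, (fun n => u n a) @ \oo --> l.
  apply: cauchy_seq_cvg => e e0.
  (* The comparison costs twice this, which is strictly below e. *)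
  have e30 : 0 < e / 3%:R by rewrite divr_gt0 // ltr0n.
  have [N osc] := osc_le_exists a e30; exists N => n Nn.
  have -> : u n = iter N push (u (n - N)%N).
    by rewrite /u -iterD subnKC.
  apply: le_lt_trans (vertex_rep_dist (ltW e30) (vu 0%N) (vu _) osc) _.
  rewrite -mulr2n -[X in X < _]mulr_natr mulrAC ltr_pdivrMr ?ltr0n //.
  by rewrite ltr_pM2l // ltr_nat.
have [rho rhoP] := choice ucvg.
have lim_unique a (l l' : B) :
    (fun n => u n a) @ \oo --> l -> (fun n => u n a) @ \oo --> l' -> l = l'.
  exact: cvg_unique (@norm_hausdorff _ B) _ _ _ _.
exists rho.
  split; first split.
  - move=> k a b; apply: (lim_unique (k *: a + b)) => //.
    have -> : (fun n => u n (k *: a + b)) = (fun n => k *: u n a + u n b).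
      by apply/funext => n; have [[-> _ _] _] := vu n.
    by apply: cvgD => //; apply: cvgZl_tmp.
  - move=> a b; apply: (lim_unique (a ** b)) => //.
    have -> : (fun n => u n (a ** b)) = (fun n => u n a ** u n b).
      by apply/funext => n; have [[_ -> _] _] := vu n.
    exact: cvg_cmul.
  - move=> a; apply: (lim_unique (star a)) => //.
    have -> : (fun n => u n (star a)) = (fun n => star (u n a)).
      by apply/funext => n; have [[_ _ ->] _] := vu n.
    exact: (cvg_comp _ _ (rhoP a) (@continuous_star _ _ _)).
  - move=> v; apply: (lim_unique (vertex_ind M v)) => //.
    have -> : (fun n => u n (vertex_ind M v)) = (fun=> P v).
      by apply/funext => n; have [_ ->] := vu n.
    exact: cvg_cst.
(* [push] at a involves finitely many values of its argument, so it commutes with pointwise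
   limits. *)
move=> a; have h : (fun n => u n.+1 a) @ \oo --> push rho a.
  apply: cvg_big => [|e _]; first exact: add_continuous.
  apply: cvg_cmul; last exact: cvg_cst.
  by apply: cvg_cmul; [exact: cvg_cst|exact: rhoP].
have := h; rewrite (cvg_shiftS (fun n => u n a)) => h'.
exact: lim_unique h' (rhoP a).
Qed.

End FixedRepresentation.

(** * A covariant representation from a Cuntz-Krieger family *)

Section GraphAlgebraRepresentation.
Variables (R : realType) (G : graph) (M : mauldin_williams R G).
Local Notation A := (cfun R (mw_total M)).
Local Notation X := (mw_correspondence M).
Hypothesis ns : no_sinks G.
Variables (B : cstarAlgType R) (P : vertex G -> B) (S : edge G -> B).
Hypothesis ck : cuntz_krieger P S.
Variable rho : A -> B.
Hypotheses (vr : vertex_rep P rho) (fixed : forall a, push S rho a = rho a).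

(** By [toeplitz_frame], the only candidate sending each edge indicator to S_e. *)
Definition edge_rep (x : X) : B := \sum_e S e ** rho (inner (edge_ind M e) x).

Lemma edge_rep_ind e : edge_rep (edge_ind M e) = S e.
Proof.
have [hr rP] := vr; rewrite /edge_rep (bigD1 e) // big1 => [|f /andP[_ fe]].
  by rewrite inner_edge_edge eqxx rP (ck_rng ck) /= addr0.
by rewrite inner_edge_edge (negbTE fe) (star_hom0 hr) cmul0r.
Qed.

Lemma edge_rep_cut e x :
  P (rng e) ** rho (inner (edge_ind M e) x) = rho (inner (edge_ind M e) x).
Proof.
by have [hr <-] := vr; rewrite -(star_homM hr) inner_edge_ind_vertex.
Qed.

(** After rewriting [rho a] as [push S rho a], multiplication by S_e keeps only the term of e. *)
Lemma fixed_commutes e a : rho a ** S e = S e ** rho (pull e a).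
Proof.
rewrite -fixed /push cmul_suml (bigD1 e) //= big1 ?addr0 => [|f fe].
  rewrite -cmulA (ck_initial ck) -cmulA; congr (_ ** _).
  have [hr <-] := vr; rewrite -(star_homM hr) cfun_mulC; congr rho.
  exact: inner_edge_ind_vertex.
by rewrite -cmulA (ck_star_orth ck) // cmul0r.
Qed.

Lemma edge_rep_toeplitz : toeplitz edge_rep rho.
Proof.
have [hr rP] := vr; split=> //.
- move=> k x y; rewrite scaler_sumr -big_split; apply: eq_bigr => e _.
  by rewrite inner_linear (star_homD hr) (star_homZ hr) cmulDr cmulZr.
- move=> x a; rewrite cmul_suml; apply: eq_bigr => e _.
  by rewrite inner_ract (star_homM hr) cmulA.
- move=> a x; rewrite cmul_sumr; apply: eq_bigr => e _.
  by rewrite inner_edge_lact (star_homM hr) !cmulA fixed_commutes.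
- move=> x y; rewrite star_sum cmul_orth_sum => [|e f ef]; last first.
    rewrite starM -cmulA [star (S e) ** (_ ** _)]cmulA (ck_star_orth ck) //.
    by rewrite cmul0l cmul0r.
  (* Expanding [x] on the right only matches the single sum left by orthogonality. *)
  rewrite [x in RHS]mw_frame inner_suml (star_hom_sum hr).
  apply: eq_bigr => e _.
  rewrite starM -cmulA [star (S e) ** (_ ** _)]cmulA (ck_initial ck).
  by rewrite edge_rep_cut inner_ractl (star_homM hr) (star_hom_star hr).
Qed.

(** The frame criterion asks that the sum of the S_e ** star S_e be a right unit for [rho a];
    without sinks that sum is the image under [rho] of the constant function 1. *)
Lemma edge_rep_covariant : cp_covariant edge_rep rho.
Proof.
apply/(cp_covariant_frame (@mw_frame R G M) edge_rep_toeplitz) => a.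
have [hr rP] := vr.
under eq_bigr do rewrite (toeplitz_lact edge_rep_toeplitz) edge_rep_ind -cmulA.
rewrite -cmul_sumr (ck_sum_final ck ns).
under eq_bigr do rewrite -rP.
by rewrite -(star_hom_sum hr) -(star_homM hr) cfun_mulC sum_vertex_ind.
Qed.

End GraphAlgebraRepresentation.

(** * A Cuntz-Krieger family from a covariant representation *)

Section CuntzPimsnerFamily.
Variables (R : realType) (G : graph) (M : mauldin_williams R G).
Variables (B : cstarAlgType R) (kX : mw_correspondence M -> B).
Variable kA : cfun R (mw_total M) -> B.
Hypotheses (ht : toeplitz kX kA) (hc : cp_covariant kX kA).
Let P v := kA (vertex_ind M v).
Let S e := kX (edge_ind M e).

(** Through [lact_edge_ind], the frame form of covariance is the fixed-point equation. *)
Lemma covariant_push a : push S kA a = kA a.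
Proof.
have /(_ a) -> := iffLR (cp_covariant_frame (@mw_frame R G M) ht) hc.
by apply: eq_bigr => e _; rewrite lact_edge_ind (toeplitz_ract ht).
Qed.

Lemma covariant_vertex_rep : vertex_rep P kA.
Proof. by split=> //; exact: toeplitz_star_hom ht. Qed.

Lemma covariant_cuntz_krieger : cuntz_krieger P S.
Proof.
have hk := toeplitz_star_hom ht.
have initial e : star (S e) ** S e = P (rng e).
  by rewrite (toeplitz_inner ht) inner_edge_edge eqxx.
split=> //.
- move=> v; split; first by rewrite -(star_hom_star hk) star_tag_indicator.
  by rewrite -(star_homM hk) tag_indicator_mul eqxx.
- move=> v w vw.
  by rewrite -(star_homM hk) tag_indicator_mul (negbTE vw) (star_hom0 hk).
- move=> e; rewrite /partial_isometry -cmulA initial -(toeplitz_ract ht).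
  by rewrite ract_edge_ind.
(* The final relation is covariance at the indicator of T_v. *)
- move=> v _; rewrite [RHS]big_mkcond /P -covariant_push.
  apply: eq_bigr => e _; rewrite pull_vertex.
  case: ifP => _; last by rewrite (star_hom0 hk) cmul0r cmul0l.
  by rewrite -(toeplitz_ract ht) ract_edge_ind.
Qed.

End CuntzPimsnerFamily.

(** * The isomorphism *)

Lemma generates_star_hom_id (R : realType) (A : cstarAlgType R) (D : set A)
    (f : A -> A) :
  generates D -> star_hom f -> (forall a, D a -> f a = a) -> forall a, f a = a.
Proof.
move=> gD hf fD a; suff E : [set x | f x = x] = setT.
  by have : [set x | f x = x] a by rewrite E.
apply: gD => //; split.
- apply: closed_equalizer; first exact: star_hom_continuous.
  by move=> x; exact: cvg_id.
- exact: star_hom0 hf.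
- by move=> k x y /= fx fy; rewrite (star_homD hf) (star_homZ hf) fx fy.
- by move=> x y /= fx fy; rewrite (star_homM hf) fx fy.
- by move=> x /= fx; rewrite (star_hom_star hf) fx.
Qed.

Theorem theorem2p3 (R : realType) (G : graph) (M : mauldin_williams R G)
    (hsinks : no_sinks G) (hsources : no_sources G)
    (O : cstarAlgType R)
    (kX : mw_correspondence M -> O) (kA : cfun R (mw_total M) -> O)
    (hO : cuntz_pimsner_algebra kX kA)
    (C : cstarAlgType R) (P : vertex G -> C) (S : edge G -> C)
    (hC : graph_algebra P S) :
  star_isomorphic O C.
Proof.
have [ht hc gO uO] := hO; have [ck gC uC] := hC.
have ckO := covariant_cuntz_krieger ht hc.
have [rho vr fixed] := fixed_vertex_rep_exists M hsinks ck.
have tp := edge_rep_toeplitz ck vr fixed.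
have [f [hf fX fA]] := uO _ _ _ tp (edge_rep_covariant hsinks ck vr fixed).
have [g [hg gP gS]] := uC _ _ _ ckO.
have gA : forall a, g (rho a) = kA a.
  (* Both sides are fixed points for the family in [O]: [kA] by covariance, [g \o rho] because [g]
     carries [S] to that family. *)
  suff -> : kA = g \o rho by [].
  apply: (fixed_vertex_rep_unique ckO).
  - exact: covariant_vertex_rep ht.
  - split; first exact: star_hom_comp (proj1 vr) hg.
    by move=> v /=; have [_ ->] := vr; rewrite gP.
  - exact: covariant_push.
  - move=> a; rewrite -[RHS]/(g (rho a)) -fixed (star_hom_sum hg).
    apply: eq_bigr => e _.
    by rewrite !(star_homM hg) (star_hom_star hg) gS.
exists f; split=> //; exists g => [y|c].
- apply: (generates_star_hom_id gO (star_hom_comp hf hg)).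
  move=> _ [[x _ <-]|[a _ <-]] /=.
    (* The frame writes [kX x] through edge indicators and values of [kA], both recovered by [g]. *)
    rewrite fX (star_hom_sum hg) (toeplitz_frame (@mw_frame R G M) ht).
    by apply: eq_bigr => e _; rewrite (star_homM hg) gS gA.
  by rewrite fA gA.
- apply: (generates_star_hom_id gC (star_hom_comp hg hf)).
  move=> _ [[v _ <-]|[e _ <-]] /=.
    by rewrite gP fA; have [_ ->] := vr.
  by rewrite gS fX (edge_rep_ind ck vr).
Qed.
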